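(* Assume that $\beta$ is constant. Then the sliding drop problem has a traveling wave solution, i.e. a solution of the form $u(x,t)=v(x-ct)$. The profile $v$ is unique up to translation, and the speed $c$ is given by $$c=\begin{cases}\frac12 V_0\kappa\sin\alpha & \text{if } V_0\le \dfrac{2\beta}{\kappa\sin\alpha},\\[6pt] V_0\kappa\sin\alpha-\beta & \text{if } V_0\ge \dfrac{2\beta}{\kappa\sin\alpha}.\end{cases}$$ Finally, any solution $w$ of the sliding drop problem converges as $t\to\infty$ to a translation of this traveling wave: there is $x_0\in\mathbb R$ such that $\sup_{x\in\mathbb R}|w(x,t)-v(x-ct-x_0)|\to0$ as $t\to\infty$.
   Context: Fix constants $V_0>0$ (volume), $\kappa>0$ and $0<\alpha<\pi/2$. Functions in $H^1_0(a,b)$ are extended by $0$ to $\mathbb R$. Set $$\mathcal F(v)=\int_{\mathbb R}\frac12|v_x|^2+\frac{v^2}{2}\kappa\cos\alpha-v\,x\,\kappa\sin\alpha\,dx .$$ Admissible initial datum: a function $u_0$ for which there are $a_0<b_0$ with $\{u_0>0\}=(a_0,b_0)$ and $u_0=\mathrm{argmin}\{\mathcal F(v): v\in H^1_0(a_0,b_0),\ v\ge 0,\ \int v\,dx=V_0\}$. Solution of the sliding drop problem with initial datum $u_0$: a function $u(x,t)$, $t\ge0$, for which there exist Lipschitz functions $a(t),b(t)$ on $[0,\infty)$ with $a(0)=a_0$, $b(0)=b_0$ such that, for all $t\ge 0$, $\{x: u(x,t)>0\}=(a(t),b(t))$ and $$u(\cdot,t)=\mathrm{argmin}\Big\{\mathcal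 F(v): v\in H^1_0(a(t),b(t)),\ v\ge0,\ \int_{a(t)}^{b(t)} v\,dx=V_0\Big\},$$ and, for a.e. $t\ge0$, $$\min\{a'(t)+\tfrac12|u_x(a(t),t)|^2-\beta(a(t)),\ |u_x(a(t),t)|\}=0,$$ $$\min\{-b'(t)+\tfrac12|u_x(b(t),t)|^2-\beta(b(t)),\ |u_x(b(t),t)|\}=0,$$ where $u_x(a(t),t)$, $u_x(b(t),t)$ are one-sided derivatives taken from inside $(a(t),b(t))$. *)

(* Defs.v *)
From HB Require Import structures.
From mathcomp Require Import all_boot all_order all_algebra.
From mathcomp Require Import all_classical all_reals all_analysis.

Set Implicit Arguments.
Unset Strict Implicit.
Unset Printing Implicit Defensive.

Import Order.TTheory GRing.Theory Num.Theory.
Import numFieldNormedType.Exports.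

Local Open Scope classical_set_scope.
Local Open Scope ring_scope.

Definition L2norm {R : realType} (f : R -> R) : \bar R :=
  Lnorm (@lebesgue_measure R) 2%:E (EFin \o f).

(* Test functions of class C^1 with compact support in [A]. *)
Definition C1c {R : realType} (A : set R) (phi : R -> R) : Prop :=
  [/\ forall x, derivable phi x 1,
      continuous (derive1 phi),
      compact (closure [set x | phi x != 0]) &
      closure [set x | phi x != 0] `<=` A].

(* [g] is a weak derivative of [v], both being square integrable on the line. *)
Definition is_wderiv {R : realType} (v g : R -> R) : Prop :=
  let mu := @lebesgue_measure R in
  [/\ v \in Lfun mu 2%:E,
      g \in Lfun mu 2%:E &
      forall phi : R -> R, C1c setT phi ->
        \int[mu]_x (v x * derive1 phi x) = - \int[mu]_x (g x * phi x)].

(* A choice of weak derivative (unique up to a null set); it is a junk value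
   when [v] is not in H^1(R). *)
Definition wderiv {R : realType} (v : R -> R) : R -> R :=
  get [set g | is_wderiv v g].

(* H^1_0(a,b), as the H^1-closure of C^1_c(a,b). Its elements are functions on
   the whole line, extended by 0, and we take their continuous representative:
   the positivity set {v > 0} below is a pointwise notion. *)
Definition H10 {R : realType} (a b : R) (v : R -> R) : Prop :=
  [/\ continuous v,
      forall x, x \notin `]a, b[ -> v x = 0,
      exists g, is_wderiv v g &
      exists phi : nat -> R -> R,
        [/\ forall n, C1c `]a, b[ (phi n),
            L2norm (fun x => phi n x - v x) @[n --> \oo] --> 0%E &
            L2norm (fun x => derive1 (phi n) x - wderiv v x)
              @[n --> \oo] --> 0%E]].

Definition energy {R : realType} (kappa alpha : R) (v : R -> R) : R :=
  let mu := @lebesgue_measure R in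
  \int[mu]_x (2^-1 * `|wderiv v x| ^+ 2
              + (v x) ^+ 2 / 2 * kappa * cos alpha
              - v x * x * kappa * sin alpha).

Definition competitor {R : realType} (V0 a b : R) (v : R -> R) : Prop :=
  let mu := @lebesgue_measure R in
  [/\ H10 a b v, forall x, 0 <= v x & \int[mu]_x v x = V0].

Definition is_argmin {R : realType} (V0 kappa alpha a b : R) (u : R -> R) :
    Prop :=
  competitor V0 a b u /\
  forall v, competitor V0 a b v ->
    energy kappa alpha u <= energy kappa alpha v.

Definition admissible_datum {R : realType} (V0 kappa alpha a0 b0 : R)
    (u0 : R -> R) : Prop :=
  [/\ a0 < b0, [set x | 0 < u0 x] = `]a0, b0[%classic &
      is_argmin V0 kappa alpha a0 b0 u0].

Definition is_right_derivative {R : realType} (f : R -> R) (x l : R) : Prop :=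
  h^-1 * (f (x + h) - f x) @[h --> 0^'+] --> l.

Definition is_left_derivative {R : realType} (f : R -> R) (x l : R) : Prop :=
  h^-1 * (f (x + h) - f x) @[h --> 0^'-] --> l.

Definition sliding_drop_solution {R : realType} (V0 kappa alpha : R)
    (beta : R -> R) (u0 : R -> R) (u : R -> R -> R) : Prop :=
  exists a0 b0 : R, admissible_datum V0 kappa alpha a0 b0 u0 /\
  exists a b : R -> R,
    [/\ exists k, k.-lipschitz_`[0, +oo[ a,
        exists k, k.-lipschitz_`[0, +oo[ b,
        a 0 = a0 /\ b 0 = b0,
        forall t, 0 <= t ->
          [set x | 0 < u x t] = `]a t, b t[%classic /\
          is_argmin V0 kappa alpha (a t) (b t) (u ^~ t) &
        {ae @lebesgue_measure R, forall t, 0 <= t ->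
          [/\ derivable a t 1,
              derivable b t 1 &
              exists p q : R,
                [/\ is_right_derivative (u ^~ t) (a t) p,
                    is_left_derivative (u ^~ t) (b t) q,
                    Num.min (derive1 a t + 2^-1 * `|p| ^+ 2 - beta (a t)) `|p|
                      = 0 &
                    Num.min (- derive1 b t + 2^-1 * `|q| ^+ 2 - beta (b t)) `|q|
                      = 0]]}].

(* The function (x, t) |-> v (x - c t) is a solution, for some initial datum. *)
Definition traveling_wave {R : realType} (V0 kappa alpha : R) (beta : R -> R)
    (v : R -> R) (c : R) : Prop :=
  exists u0, sliding_drop_solution V0 kappa alpha beta u0
               (fun x t => v (x - c * t)).

(* Main.v *)
From HB Require Import structures.
From mathcomp Require Import all_boot all_order all_algebra.
From mathcomp Require Import all_classical all_reals all_analysis.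
From mathcomp Require Import measurable_realfun ring lra.
Require Import Defs.

Set Implicit Arguments.
Unset Strict Implicit.
Unset Printing Implicit Defensive.

Import Order.TTheory GRing.Theory Num.Theory.
Import numFieldNormedType.Exports.

Local Open Scope classical_set_scope.
Local Open Scope ring_scope.

(** Put K = kappa cos alpha, S = kappa sin alpha and k = sqrt K.

    Minimisers are explicit. On a fixed interval the energy is a strictly
    convex quadratic functional, and small interior variations of a function
    that is positive inside the interval stay nonnegative. Hence a minimiser
    with that positivity set solves the linear equation
    - u'' + K u = S x + lambda with zero boundary values ([argmin_EL]), the
    multiplier lambda being fixed by the volume; conversely a nonnegative
    solution is the unique minimiser ([EL_argmin], [EL_unique]). For midpoint m
    and half-length l the solution is a combination of an affine function, sinh
    and cosh, called [drop l m] below. So a solution of the sliding drop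
    problem is a curve t |-> (l t, m t).

    The slopes at the contact points depend on l only. With
    rho s = s coth s - 1, A = V0 K / 2, B = S / K and r = rho (k l), the left
    one is p = A / r - B r and the right one is q = - A / r - B r. As rho is
    increasing from 0 to infinity, p is strictly decreasing in l and takes every
    nonnegative value; moreover q < 0 and q^2 - p^2 = 2 V0 S. The drop is
    positive inside its interval exactly when p >= 0 ([prof_gt0],
    [right_derivative_ge0]).

    The evolution is then an ordinary differential inequality. Since q < 0, the
    right contact point moves with velocity p^2 / 2 + V0 S - beta. The left one
    moves with velocity beta - p^2 / 2 as long as p > 0; where p = 0 its
    velocity is at least beta, but there l has its largest possible value, so
    that l' = 0. Let P = sqrt (2 beta - V0 S), or 0 if this is not defined, and
    let l0 be the half-length with p = P. In all cases
      (l - l0) l' <= (l - l0) (p^2 - P^2) / 2,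
    and the right-hand side is negative for l <> l0 because p is decreasing in
    l. So (l - l0)^2 is a Lyapunov function and l tends to l0
    ([dissipative_cvg], [drop_dynamics]).

    If V0 S < 2 beta, then m' = V0 S / 2 almost everywhere. If V0 S >= 2 beta,
    then m' <= c while m' + l' >= c, for c = V0 S - beta; hence m - c t is
    nonincreasing, and bounded below because l is bounded. Either way m - c t
    converges, and the drops converge uniformly ([drop_uniform_cvg]). The drop
    of half-length l0 moving with speed c is a solution, and it is the only
    wave: along a wave l is constant, hence equal to its limit l0. *)

(** * The inner product of square integrable functions *)
Section L2.
Context {R : realType}.
Notation mu := (@lebesgue_measure R).
Implicit Types f g h : R -> R.

Definition ip f g : R := \int[mu]_x (f x * g x).

Notation L2 := (Lfun mu 2%:E).

Lemma ae_imp (P Q : R -> Prop) : {ae mu, forall x, P x} ->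
  (forall x, P x -> Q x) -> {ae mu, forall x, Q x}.
Proof.
move=> hP PQ; apply: negligibleS hP => x nQ Px; exact/nQ/PQ.
Qed.

Lemma L2normE f :
  L2norm f = poweR (\int[mu]_x ((f x) ^+ 2)%:E)%E 2^-1.
Proof.
rewrite /L2norm Lnorm.unlock /Lnorm.body; congr poweR.
apply: eq_integral => x _ /=.
by rewrite powR_mulrn// real_normK ?num_real.
Qed.

Lemma L2_measurable f : f \in L2 -> measurable_fun setT f.
Proof. by move=> /andP[/[!inE]]. Qed.

Lemma L2_ip_integrable f g : f \in L2 -> g \in L2 ->
  mu.-integrable setT (EFin \o (fun x => f x * g x)).
Proof. by move=> hf hg; apply/Lfun1_integrable; exact: Lfun2_mul_Lfun1. Qed.

Lemma L2P f : measurable_fun setT f ->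
  mu.-integrable setT (EFin \o (fun x => f x ^+ 2)) -> f \in L2.
Proof.
move=> mf /integrableP[_ intf]; rewrite inE; apply/andP; split; rewrite inE//=.
rewrite /finite_norm unlock poweR_lty//.
apply: le_lt_trans intf; rewrite le_eqVlt; apply/orP; left; apply/eqP.
apply: eq_integral => x _ /=.
by rewrite powR_mulrn// normrX.
Qed.

Lemma le12 : (1 <= 2%:E :> \bar R)%E. Proof. by rewrite lee_fin ler1n. Qed.

Lemma L2D f g : f \in L2 -> g \in L2 -> (fun x => f x + g x) \in L2.
Proof.
move=> hf hg.
have [_ /(_ 1 f g hf hg)] := Lfun_submod_closed mu le12.
rewrite (_ : 1 *: f + g = (fun x => f x + g x))//.
by apply/funext => x; rewrite /= [LHS]/GRing.add/= scale1r.
Qed.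

Lemma L2Z c f : f \in L2 -> (fun x => c * f x) \in L2.
Proof.
move=> hf; have := @Lfun_scale _ _ _ mu f c 2 (ler1n _ 2) hf.
by rewrite (_ : c \o* f = (fun x => c * f x))//; apply/funext => x /=; rewrite mulrC.
Qed.

Lemma L2B f g : f \in L2 -> g \in L2 -> (fun x => f x - g x) \in L2.
Proof.
move=> hf hg; have := L2D hf (L2Z (-1) hg).
rewrite (_ : (fun x => f x + -1 * g x) = (fun x => f x - g x))//.
by apply/funext => x; rewrite mulN1r.
Qed.

Lemma ipC f g : ip f g = ip g f.
Proof. by apply: eq_Rintegral => x _; rewrite mulrC. Qed.

Lemma ipDr f g h : f \in L2 -> g \in L2 -> h \in L2 ->
  ip f (fun x => g x + h x) = ip f g + ip f h.
Proof.
move=> hf hg hh; rewrite /ip -RintegralD//; [|exact: L2_ip_integrable..].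
by apply: eq_Rintegral => x _; rewrite mulrDr.
Qed.

Lemma ipZr c f g : f \in L2 -> g \in L2 -> ip f (fun x => c * g x) = c * ip f g.
Proof.
move=> hf hg; rewrite /ip -RintegralZl//; last exact: L2_ip_integrable.
by apply: eq_Rintegral => x _; rewrite mulrCA.
Qed.

Lemma ipBr f g h : f \in L2 -> g \in L2 -> h \in L2 ->
  ip f (fun x => g x - h x) = ip f g - ip f h.
Proof.
move=> hf hg hh; rewrite /ip -RintegralB//; [|exact: L2_ip_integrable..].
by apply: eq_Rintegral => x _; rewrite mulrBr.
Qed.

Lemma ip_ge0 f : 0 <= ip f f.
Proof. by apply: Rintegral_ge0 => x _; rewrite -expr2 sqr_ge0. Qed.

Lemma ip_sqB f g : f \in L2 -> g \in L2 ->
  ip (fun x => f x - g x) (fun x => f x - g x) = ip f f - 2 * ip f g + ip g g.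
Proof.
move=> hf hg; rewrite ipBr ?L2B// (ipC _ f) (ipC _ g) !ipBr//.
rewrite (ipC g f); ring.
Qed.

Lemma ip_sqD f g : f \in L2 -> g \in L2 ->
  ip (fun x => f x + g x) (fun x => f x + g x) = ip f f + 2 * ip f g + ip g g.
Proof.
move=> hf hg; rewrite ipDr ?L2D// (ipC _ f) (ipC _ g) !ipDr//.
rewrite (ipC g f); ring.
Qed.

Lemma ip_eq0 f : f \in L2 -> ip f f = 0 -> {ae mu, forall x, f x = 0}.
Proof.
move=> hf h0; have if2 := L2_ip_integrable hf hf.
have : (\int[mu]_x `|(f x * f x)%:E|)%E = 0%E.
  have /fineK <- : (\int[mu]_x `|(f x * f x)%:E| \is a fin_num)%E.
    by move/integrableP: if2 => [_]; rewrite ge0_fin_numE//; exact: integral_ge0.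
  rewrite -[RHS]/(0%:E) -h0; congr (_%:E); congr fine.
  by apply: eq_integral => x _ /=; rewrite ger0_norm// -expr2 sqr_ge0.
move/ae_eq_integral_abs => /(_ measurableT) H.
have {}H := H (measurable_int _ if2).
apply: filterS H => x /(_ I) /= -[] /eqP; rewrite mulf_eq0 orbb => /eqP.
by [].
Qed.

Lemma ip_ae f g h : measurable_fun setT f -> measurable_fun setT g ->
  measurable_fun setT h -> {ae mu, forall x, f x = g x} -> ip f h = ip g h.
Proof.
move=> mf mg mh fg; congr fine; apply: ae_eq_integral => //.
- by apply/measurable_EFinP; exact: measurable_funM.
- by apply/measurable_EFinP; exact: measurable_funM.
- by apply: (ae_imp fg) => x -> _.
Qed.

Lemma L2norm_ae f g : measurable_fun setT f -> measurable_fun setT g ->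
  {ae mu, forall x, f x = g x} -> L2norm f = L2norm g.
Proof.
move=> mf mg fg; rewrite !L2normE; congr poweR.
apply: ae_eq_integral => //.
- by apply/measurable_EFinP; exact: measurable_funX.
- by apply/measurable_EFinP; exact: measurable_funX.
- by apply: (ae_imp fg) => x /= -> _.
Qed.

Lemma L2norm_fin f : f \in L2 -> L2norm f \is a fin_num.
Proof. by move=> /andP[_]; rewrite inE/= ge0_fin_numE// Lnorm_ge0. Qed.

Lemma ip_CS f g : f \in L2 -> g \in L2 ->
  ((`|ip f g|)%:E <= L2norm f * L2norm g)%E.
Proof.
move=> hf hg; rewrite EFin_normr_Rintegral//; last exact: L2_ip_integrable.
apply: le_trans (le_abse_integral _ _ _) _ => //.
  by apply: measurable_int; exact: L2_ip_integrable.
have := @hoelder _ _ _ mu f g 2 2 (L2_measurable hf) (L2_measurable hg).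
rewrite Lnorm1; apply => //; lra.
Qed.

Lemma cvg_ip (fn : nat -> R -> R) f g : (forall n, fn n \in L2) -> f \in L2 ->
  g \in L2 -> L2norm (fun x => fn n x - f x) @[n --> \oo] --> 0%E ->
  ip (fn n) g @[n --> \oo] --> ip f g.
Proof.
move=> hfn hf hg cv.
have hd n : (fun x => fn n x - f x) \in L2 by exact: L2B.
have cv1 : fine (L2norm (fun x => fn n x - f x)) @[n --> \oo] --> (0 : R).
  exact: fine_cvg.
have cv2 : fine (L2norm (fun x => fn n x - f x)) * fine (L2norm g)
    @[n --> \oo] --> (0 : R).
  by rewrite -(mul0r (fine (L2norm g))); apply: cvgM => //; exact: cvg_cst.
apply/cvgrPdist_le => e e0; move/cvgr0_norm_le : cv2 => /(_ e e0).
apply: filterS => n; apply: le_trans.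
rewrite distrC ipC (ipC f) -ipBr// -lee_fin ipC; apply: le_trans (ip_CS _ _) _ => //.
rewrite -[X in (X * _)%E]fineK ?L2norm_fin// -[X in (_ * X)%E]fineK ?L2norm_fin//.
by rewrite -EFinM lee_fin ler_norm.
Qed.

End L2.
Notation "'L2" := (Lfun (@lebesgue_measure _) 2%:E).

(** * Functions with bounded support and test functions *)
Section C1.
Context {R : realType}.
Notation mu := (@lebesgue_measure R).
Implicit Types f g h : R -> R.

Definition off0 (c d : R) f := forall x, x \notin `[c, d] -> f x = 0.

Lemma off0_sub c d c' d' f : c' <= c -> d <= d' -> off0 c d f -> off0 c' d' f.
Proof.
move=> cc dd h x xn; apply: h; apply: contra xn.
by rewrite !in_itv/= => /andP[x1 x2]; rewrite (le_trans cc x1) (le_trans x2 dd).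
Qed.

Lemma bounded_support_integrable f (c d M : R) : measurable_fun setT f ->
  (forall x, `|f x| <= M) -> off0 c d f -> mu.-integrable setT (EFin \o f).
Proof.
move=> mf fM f0.
rewrite (_ : EFin \o f = (EFin \o f) \_ `[c, d]); last first.
  apply/funext => x; rewrite patchE; case: ifPn => //= xn.
  by rewrite f0//; apply: contra xn => xn; rewrite inE.
have [H _] := @integrable_mkcond _ _ _ mu `[c, d]%classic (EFin \o f)
  (measurable_itv `[c, d]).
apply: H.
apply: measurable_bounded_integrable => //.
- by rewrite /= lebesgue_measure_itv/=; case: ifP => // _; rewrite -EFinD ltry.
- exact: measurable_funTS.
- exists M; split; first exact: num_real.
  by move=> x Mx y _ /=; rewrite (le_trans (fM y))// ltW.
Qed.

Lemma bounded_support_L2 f (c d M : R) : measurable_fun setT f ->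
  (forall x, `|f x| <= M) -> off0 c d f -> f \in 'L2.
Proof.
move=> mf fM f0; apply: L2P => //.
apply: (@bounded_support_integrable _ c d (M ^+ 2)).
- exact: measurable_funX.
- by move=> x; rewrite normrX ler_sqr ?nnegrE// (le_trans _ (fM x)).
- by move=> x /f0 ->; rewrite expr0n.
Qed.

Lemma L2norm_sqrt f : f \in 'L2 -> L2norm f = (Num.sqrt (ip f f))%:E.
Proof.
move=> hf; rewrite L2normE -powR12_sqrt ?ip_ge0// -poweR_EFin; congr poweR.
rewrite /ip /Rintegral fineK; last first.
  by apply: integrable_fin_num => //; exact: L2_ip_integrable.
by apply: eq_integral => x _; rewrite expr2.
Qed.

Lemma Rintegral_dct (fn : nat -> R -> R) f (c d M : R) :
  (forall n, measurable_fun setT (fn n)) -> measurable_fun setT f ->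
  (forall n x, `|fn n x| <= M) -> (forall n, off0 c d (fn n)) ->
  (forall x, fn n x @[n --> \oo] --> f x) ->
  \int[mu]_x fn n x @[n --> \oo] --> \int[mu]_x f x.
Proof.
move=> mfn mf fnM fn0 cv.
pose g x := M * (\1_(`[c, d]%classic : set R) x).
have M0 : 0 <= M by rewrite (le_trans _ (fnM 0%N 0)).
have g_ge0 x : 0 <= g x by rewrite mulr_ge0// indicE; case: (_ \in _).
have ig : mu.-integrable setT (EFin \o g).
  apply: (@bounded_support_integrable _ c d M).
  - by apply: measurable_funM => //; exact: measurable_indic.
  - move=> x; rewrite ger0_norm// /g indicE; case: (_ \in _) => /=; lra.
  - by move=> x xn; rewrite /g indicE (_ : _ \in _ = false) ?mulr0// memNset//=; exact/negP.
have [|||||int_f _ C] := @dominated_convergence _ _ _ mu setT measurableT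
  (fun n => EFin \o fn n) (EFin \o f) (EFin \o g).
- by move=> n; apply/measurable_EFinP; exact: mfn.
- exact/measurable_EFinP.
- by apply: aeW => x _; apply/fine_cvgP; split; [exact: nearW|exact: cv].
- by [].
- apply: aeW => x n _ /=; rewrite lee_fin /g indicE.
  case: (boolP (x \in `[c, d])) => xcd.
    by rewrite mem_set//= mulr1.
  by rewrite fn0// normr0 mulr_ge0.
apply: fine_cvg; rewrite fineK; last exact: integrable_fin_num.
exact: C.
Qed.

Lemma L2norm_dct (fn : nat -> R -> R) (c d M : R) :
  (forall n, measurable_fun setT (fn n)) ->
  (forall n x, `|fn n x| <= M) -> (forall n, off0 c d (fn n)) ->
  (forall x, fn n x @[n --> \oo] --> (0 : R)) ->
  L2norm (fn n) @[n --> \oo] --> 0%E.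
Proof.
move=> mfn fnM fn0 cv.
have L2fn n : fn n \in 'L2 by exact: (@bounded_support_L2 _ c d M).
under eq_fun do rewrite L2norm_sqrt//.
apply/fine_cvgP; split; first exact: nearW.
rewrite -[X in _ --> X]/(0 : R) -sqrtr0.
apply: continuous_cvg; first exact: sqrt_continuous.
have -> : (0 : R) = \int[mu]_x (cst 0 x).
  by rewrite /Rintegral integral0.
apply: (@Rintegral_dct _ _ c d (M ^+ 2)) => //.
- by move=> n; exact: measurable_funM.
- by move=> n x; rewrite -expr2 normrX ler_sqr ?nnegrE// (le_trans _ (fnM n x)).
- by move=> n x /fn0 ->; rewrite mulr0.
- by move=> x; rewrite -[X in _ --> X](mulr0 0); apply: cvgM.
Qed.

Definition C1 f f' := (forall x : R, is_derive x 1 f (f' x)) /\ continuous f'.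

Lemma C1_continuous f f' : C1 f f' -> continuous f.
Proof.
move=> [df _] x; apply: differentiable_continuous.
by apply/derivable1_diffP; exact: ex_derive.
Qed.

Lemma C1_derive1 f f' : C1 f f' -> derive1 f = f'.
Proof. by move=> [df _]; apply/funext => x; rewrite derive1E derive_val. Qed.

Lemma C1c_C1 A f : C1c A f -> C1 f (derive1 f).
Proof. by move=> [df cf _ _]; split=> // x; rewrite derive1E; exact: derivableP. Qed.

Lemma C1c_sub A B f : A `<=` B -> C1c A f -> C1c B f.
Proof. by move=> AB [? ? ? fA]; split=> //; exact: subset_trans fA AB. Qed.

Lemma C1c_supp A f x : C1c A f -> ~ A x -> f x = 0.
Proof.
move=> [_ _ _ fA] nA; apply: contrapT => fx; apply/nA/fA/subset_closure => /=.
exact/eqP.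
Qed.

Lemma C1c_derive1_supp A f x : C1c A f -> ~ A x -> derive1 f x = 0.
Proof.
move=> [_ _ _ fA] nA; set S := closure _ in fA.
have oS : open (~` S) by apply: closed_openC; exact: closed_closure.
have nS : (~` S) x by move=> /fA.
rewrite derive1E -[RHS](derive_cst (0 : R) x 1); apply: near_eq_derive.
near=> y; apply: contrapT => fy.
have : (~` S) y by near: y; exact: open_nbhs_nbhs.
by apply; apply: subset_closure => /=; apply/eqP.
Unshelve. all: by end_near. Qed.

Lemma C1c_bounded f : C1c setT f -> exists M : R, 0 < M /\
  [/\ off0 (- M) M f, off0 (- M) M (derive1 f), forall x, `|f x| <= M &
      forall x, `|derive1 f x| <= M].
Proof.
move=> hf; have [df cdf cS _] := hf; set S := closure _ in cS.
have fS : C1c S f by case: hf => *; split.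
have cf : continuous f := C1_continuous (C1c_C1 hf).
have bnd h : continuous h -> exists2 M : R, 0 < M & forall x, S x -> `|h x| <= M.
  move=> ch; have : compact (h @` S).
    by apply: continuous_compact => //; exact: continuous_subspaceT.
  move=> /compact_bounded [M [_ hM]]; exists (`|M| + 1); first by rewrite ltr_wpDl.
  move=> x Sx; apply: hM; last by exists x.
  by rewrite (le_lt_trans (ler_norm M))// ltrDl.
have [M1 M10 h1] := bnd _ cf; have [M2 M20 h2] := bnd _ cdf.
have [M3 M30 h3] : exists2 M : R, 0 < M & forall x, S x -> `|x| <= M.
  by apply: bnd => x; exact: cvg_id.
exists (M1 + M2 + M3); split; first lra.
have out x : x \notin `[(- (M1 + M2 + M3)), (M1 + M2 + M3)] -> ~ S x.
  move=> + /h3; rewrite ler_norml => /negP + /andP[x1 x2]; apply.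
  rewrite in_itv/=; apply/andP; split; lra.
split.
- by move=> x /out nS; exact: (C1c_supp fS).
- by move=> x /out nS; exact: (C1c_derive1_supp fS).
- move=> x; have [/h1|/(C1c_supp fS) ->] := pselect (S x); rewrite ?normr0; lra.
- move=> x; have [/h2|/(C1c_derive1_supp fS) ->] := pselect (S x); rewrite ?normr0; lra.
Qed.

Lemma C1c_intro A f f' c d : C1 f f' -> off0 c d f -> `[c, d]%classic `<=` A ->
  C1c A f.
Proof.
move=> hf f0 cdA; have dE := C1_derive1 hf; have [df cf'] := hf.
have sub : closure [set x | f x != 0] `<=` `[c, d]%classic.
  have /closure_id -> : closed (`[c, d]%classic : set R) by exact: itv_closed.
  apply: closureS => x /=; apply: contraNT => /f0 ->.
  by [].
split.
- by move=> x; exact: ex_derive.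
- by rewrite dE.
- apply: (subclosed_compact _ (@segment_compact R c d)) => //.
  exact: closed_closure.
- exact: subset_trans sub cdA.
Qed.

Lemma C1c_comb A f g k : C1c A f -> C1c A g ->
  C1c A (fun x => f x + k * g x) /\
  derive1 (fun x => f x + k * g x) = (fun x => derive1 f x + k * derive1 g x).
Proof.
move=> hf hg; have [df cdf cSf Af] := hf; have [dg cdg cSg Ag] := hg.
have H : C1 (fun x => f x + k * g x) (fun x => derive1 f x + k * derive1 g x).
  split=> [x|].
    rewrite !derive1E.
    have ? := derivableP (df x); have ? := derivableP (dg x).
    have -> : (fun x => f x + k * g x) = f + (k *: (g : R -> R^o)) by [].
    exact: is_deriveD.
  move=> x; apply: cvgD; first exact: cdf.
  by apply: cvgM; [exact: cvg_cst|exact: cdg].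
have sub : closure [set x | f x + k * g x != 0] `<=`
  closure [set x | f x != 0] `|` closure [set x | g x != 0].
  rewrite -closureU; apply: closureS => x /=.
  have [->|?] := eqVneq (f x) 0; last by left.
  by rewrite add0r mulf_eq0 negb_or => /andP[_ ?]; right.
split; last exact: C1_derive1 H.
split.
- by case: H => H _ x; exact: ex_derive.
- by rewrite (C1_derive1 H); case: H.
- apply: subclosed_compact sub; first exact: closed_closure.
  exact: compactU.
- by apply: subset_trans sub _; rewrite subUset.
Qed.

Lemma C1c_L2 f : C1c setT f -> f \in 'L2 /\ derive1 f \in 'L2.
Proof.
move=> hf; have [M [M0 [f0 df0 fM dfM]]] := C1c_bounded hf.
split; apply: (@bounded_support_L2 _ (- M) M M) => //.
- apply: continuous_measurable_fun; exact: C1_continuous (C1c_C1 hf).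
- apply: continuous_measurable_fun; by case: hf.
Qed.

Lemma C1_derivable_oo_LR f f' c d : C1 f f' -> derivable_oo_LRcontinuous f c d.
Proof.
move=> hf; have cf := C1_continuous hf; split.
- by move=> x _; case: hf => df _; exact: ex_derive.
- exact/cvg_at_right_filter/cf.
- exact/cvg_at_left_filter/cf.
Qed.

Lemma Rint_ibp f f' g g' c d : c < d -> C1 f f' -> C1 g g' ->
  f c * g c = 0 -> f d * g d = 0 ->
  \int[mu]_(x in `[c, d]) (f x * g' x) = - \int[mu]_(x in `[c, d]) (f' x * g x).
Proof.
move=> cd hf hg gc gd.
rewrite (@Rintegration_by_parts _ f g f' g' c d) //.
- by rewrite gd gc subrr sub0r.
- by apply: continuous_subspaceT; case: hf.
- exact: C1_derivable_oo_LR hf.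
- by move=> x _; rewrite (C1_derive1 hf).
- by apply: continuous_subspaceT; case: hg.
- exact: C1_derivable_oo_LR hg.
- by move=> x _; rewrite (C1_derive1 hg).
Qed.

Lemma Rint_off0 f c d : off0 c d f ->
  \int[mu]_x f x = \int[mu]_(x in `[c, d]) f x.
Proof.
move=> f0; rewrite [RHS]Rintegral_mkcond; apply: eq_Rintegral => x _.
rewrite patchE; case: ifPn => // xn; apply: f0; apply: contra xn => xn.
by rewrite inE.
Qed.

Lemma ip_ibp f f' phi : C1 f f' -> C1c setT phi ->
  ip f (derive1 phi) = - ip f' phi.
Proof.
move=> hf hphi; have [M [M0 [f0 df0 _ _]]] := C1c_bounded hphi.
have hp := C1c_C1 hphi.
(* the extra 1 puts the end points outside the support, so that there are no
   boundary terms *)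
have e : phi (- M - 1) = 0 by apply: f0; rewrite in_itv/= negb_and; apply/orP; left; lra.
have e' : phi (M + 1) = 0 by apply: f0; rewrite in_itv/= negb_and; apply/orP; right; lra.
rewrite /ip !(@Rint_off0 _ (- M - 1) (M + 1)).
- apply: Rint_ibp => //; [lra|by rewrite e mulr0|by rewrite e' mulr0].
- by move=> x /(@off0_sub (-M) M) h; rewrite (h phi) ?mulr0//; lra.
- by move=> x /(@off0_sub (-M) M) h; rewrite (h (derive1 phi)) ?mulr0//; lra.
Qed.

End C1.

(** * Cut-off functions of an interval *)
Section cutoff.
Context {R : realType}.
Implicit Types f g h : R -> R.

Lemma is_derive_funD f g (x df dg : R) : is_derive x 1 f df -> is_derive x 1 g dg ->
  is_derive x 1 (fun y => f y + g y) (df + dg).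
Proof. exact: is_deriveD. Qed.

Lemma is_derive_funM f g (x df dg : R) : is_derive x 1 f df -> is_derive x 1 g dg ->
  is_derive x 1 (fun y => f y * g y) (df * g x + f x * dg).
Proof.
move=> hf hg; apply: is_derive_eq (is_deriveM hf hg) _.
by rewrite /GRing.scale/=; ring.
Qed.

Lemma is_derive_funZ f (k x df : R) : is_derive x 1 f df ->
  is_derive x 1 (fun y => k * f y) (k * df).
Proof. by move=> hf; have := is_deriveZ k hf. Qed.

Lemma is_derive_fun_cst (k x : R) : is_derive x 1 (fun _ : R => k) 0.
Proof. exact: is_derive_cst. Qed.

Lemma is_derive_fun_id (x : R) : is_derive x 1 (fun y : R => y) 1.
Proof. exact: is_derive_id. Qed.

Lemma is_derive_continuous f (x df : R) : is_derive x 1 f df -> {for x, continuous f}.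
Proof.
move=> hf; apply: differentiable_continuous.
by apply/derivable1_diffP; exact: ex_derive.
Qed.

(** The square of the positive part: an explicit C^1 function that vanishes on
    a half-line, from which the cut-offs are built. *)
Definition possq (s : R) := Num.max 0 s ^+ 2.

Lemma max0_continuous : continuous (fun s : R => Num.max 0 s).
Proof. by move=> s; apply: continuous_max; [exact: cvg_cst|exact: cvg_id]. Qed.

Lemma is_derive_possq (s : R) : is_derive s 1 possq (2 * Num.max 0 s).
Proof.
have [s0|s0|->] := ltgtP s 0.
- apply: (@near_eq_is_derive _ _ _ (fun=> 0)).
    near=> y; rewrite /possq max_l ?expr0n//.
    by apply: ltW; near: y; exact: lt_nbhsl.
  by rewrite mulr0; exact: is_derive_fun_cst.
- apply: (@near_eq_is_derive _ _ _ (fun y : R => y * y)).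
    near=> y; rewrite /possq max_r ?expr2//.
    by apply: ltW; near: y; exact: lt_nbhsr.
  apply: is_derive_eq (is_derive_funM (is_derive_fun_id s) (is_derive_fun_id s)) _.
  by ring.
- apply/is_derive1_caratheodory; exists (fun z => Num.max 0 z); split.
  + move=> z; rewrite /possq maxxx expr0n/= !subr0.
    have [z0|z0] := leP 0 z; rewrite ?expr2//; ring.
  + exact: max0_continuous.
  + by rewrite maxxx mulr0.
Unshelve. all: by end_near. Qed.

Lemma C1M f f' g g' : C1 f f' -> C1 g g' ->
  C1 (fun x => f x * g x) (fun x => f' x * g x + f x * g' x).
Proof.
move=> hf hg; have cf := C1_continuous hf; have cg := C1_continuous hg.
move: hf hg => [df cf'] [dg cg']; split=> [x|x]; first exact: is_derive_funM.
by apply: cvgD; apply: cvgM; [exact: cf'|exact: cg|exact: cf|exact: cg'].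
Qed.

Lemma C1_comp f f' g g' : C1 f f' -> C1 g g' ->
  C1 (fun x => f (g x)) (fun x => f' (g x) * g' x).
Proof.
move=> [df cf'] hg; have cg := C1_continuous hg.
move: hg => [dg cg']; split=> [x|x]; first exact: is_derive1_comp.
apply: cvgM; last exact: cg'.
by apply: continuous_comp; [exact: cg|exact: cf'].
Qed.

(** Vanishes for s <= 1 and approaches 1 like 1 / s^2, with a derivative of
    order 1 / s^3. Being rational in [possq], it has elementary bounds. *)
Definition smoothstep (s : R) := 1 - (1 + possq (s - 1))^-1.
Definition smoothstep' (s : R) :=
  2 * Num.max 0 (s - 1) / (1 + possq (s - 1)) ^+ 2.

Lemma possq_ge0 s : 0 <= possq s. Proof. exact: sqr_ge0. Qed.

Lemma smoothstep_C1 : C1 smoothstep smoothstep'.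
Proof.
have den s : 1 + possq (s - 1) != 0 by rewrite gt_eqF// ltr_wpDr// possq_ge0.
have dsub (s : R) : is_derive s 1 (fun y : R => y - 1) 1.
  apply: is_derive_eq (is_derive_funD (is_derive_fun_id s) (is_derive_fun_cst (-1) s)) _.
  by rewrite addr0.
have dd (s : R) : is_derive s 1 (fun y => 1 + possq (y - 1)) (2 * Num.max 0 (s - 1)).
  have h := @is_derive1_comp _ possq (fun y => y - 1) s _ _ (is_derive_possq (s - 1)) (dsub s).
  apply: is_derive_eq (is_derive_funD (is_derive_fun_cst 1 s) h) _.
  by rewrite add0r mulr1.
split=> [s|s].
  have h := @is_deriveV _ (fun y => 1 + possq (y - 1)) s _ _ (den s) (dd s).
  have := is_derive_funD (is_derive_fun_cst 1 s) (is_deriveN h).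
  move=> h2; apply: is_derive_eq h2 _.
  by rewrite /smoothstep' /GRing.scale/= add0r mulNr opprK mulrC.
have cs : {for s, continuous (fun y : R => Num.max 0 (y - 1))}.
  by apply: continuous_comp; [exact: is_derive_continuous (dsub s)|exact: max0_continuous].
apply: cvgM; first by apply: cvgM; [exact: cvg_cst|exact: cs].
apply: cvgV; first by rewrite expf_neq0.
pose d y : R := 1 + possq (y - 1).
by apply: (@cvgM _ _ _ _ d d); exact: is_derive_continuous (dd s).
Qed.

Lemma smoothstep_bound s : 0 <= smoothstep s <= 1.
Proof.
have h := possq_ge0 (s - 1).
have i0 : 0 < (1 + possq (s - 1))^-1 by rewrite invr_gt0; lra.
have i1 : (1 + possq (s - 1))^-1 <= 1 by rewrite invf_le1; lra.
by rewrite /smoothstep; apply/andP; split; lra.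
Qed.

Lemma smoothstep_le1 s : s <= 1 -> smoothstep s = 0.
Proof.
move=> s1; rewrite /smoothstep /possq max_l; last lra.
by rewrite expr0n/= addr0 invr1 subrr.
Qed.

Lemma smoothstep'_le1 s : s <= 1 -> smoothstep' s = 0.
Proof.
by move=> s1; rewrite /smoothstep' max_l; [rewrite mulr0 mul0r|lra].
Qed.

Lemma smoothstep_compl s : 1 < s -> 0 <= s * (1 - smoothstep s) <= 2.
Proof.
move=> s1; rewrite /smoothstep /possq max_r; last lra.
move: s1; have [z ->] : exists z, s = z + 1 by exists (s - 1); lra.
move=> z1; rewrite addrK; have d0 : 0 < 1 + z ^+ 2 by nra.
rewrite (_ : 1 - (1 - _) = (1 + z ^+ 2)^-1); last by ring.
by rewrite ler_pdivrMr// divr_ge0/=; nra.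
Qed.

(** When s = n theta, one factor s absorbs the n of the chain rule, and the other
    one provides the decay in n of [mul_cutoff'_bound]. *)
Lemma smoothstep'_bound s : 0 <= s -> 0 <= smoothstep' s /\ s ^+ 2 * smoothstep' s <= 2.
Proof.
move=> s0; have [s1|s1] := leP s 1.
  by rewrite smoothstep'_le1// mulr0.
rewrite /smoothstep' /possq max_r; last lra.
have [z ez] : exists z, s = z + 1 by exists (s - 1); lra.
have z0 : 0 < z by lra.
rewrite ez addrK; have d0 : 0 < (1 + z ^+ 2) ^+ 2 by nra.
split; first by rewrite divr_ge0//; [lra|exact: ltW].
rewrite mulrA ler_pdivrMr//.
have : (z + 1) ^+ 2 <= 2 * (1 + z ^+ 2) by have := sqr_ge0 (z - 1); nra.
have : 2 * z <= 1 + z ^+ 2 by have := sqr_ge0 (z - 1); nra.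
move=> h1 h2; apply: (le_trans (ler_pM _ _ h2 h1)); [nra|lra|].
by rewrite expr2; lra.
Qed.

Variables (a b : R).
(** A smooth substitute for the distance to the end points of [a, b]. *)
Definition theta (x : R) := (x - a) * (b - x).

Lemma theta_C1 : C1 theta (fun x => a + b - 2 * x).
Proof.
have h1 : C1 (fun x : R => x - a) (fun=> 1 + 0).
  by split=> [x|x]; [exact: is_derive_funD|exact: cvg_cst].
have h2 : C1 (fun x : R => b - x) (fun=> 0 + - 1).
  by split=> [x|x]; [exact: is_derive_funD|exact: cvg_cst].
have := C1M h1 h2; rewrite /C1 /theta => -[h3 h4]; split.
  by move=> x; apply: is_derive_eq (h3 x) _; ring.
move=> x; rewrite (_ : (fun _ => _) = (fun x => (1 + 0) * (b - x) + (x - a) * (0 - 1)))//.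
by apply/funext => y; ring.
Qed.

Definition cutoff (n : nat) (x : R) := smoothstep (n.+1%:R * theta x).
Definition cutoff' (n : nat) (x : R) :=
  smoothstep' (n.+1%:R * theta x) * (n.+1%:R * (a + b - 2 * x)).

Lemma cutoff_C1 n : C1 (cutoff n) (cutoff' n).
Proof.
apply: C1_comp smoothstep_C1 _; have [h1 h2] := theta_C1; split.
  by move=> x; exact: is_derive_funZ.
by move=> x; apply: cvgM; [exact: cvg_cst|exact: h2].
Qed.

Hypothesis ab : a < b.

Lemma theta_gt0 x : (0 < theta x) = (x \in `]a, b[).
Proof.
rewrite in_itv/= /theta; apply/idP/andP => [h|[h1 h2]].
  split; rewrite ltNge; apply/negP => h'.
    have : 0 <= (a - x) * (b - x) by rewrite mulr_ge0 ?subr_ge0// (le_trans h' (ltW ab)).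
    nra.
  have : 0 <= (x - a) * (x - b) by rewrite mulr_ge0 ?subr_ge0// (le_trans (ltW ab) h').
  nra.
by rewrite mulr_gt0// subr_gt0.
Qed.

Lemma theta_le x : x \in `]a, b[ -> theta x <= (b - a) * (x - a) /\
  theta x <= (b - a) * (b - x).
Proof. by rewrite in_itv/= /theta => /andP[h1 h2]; split; nra. Qed.

Lemma cutoff_off n x : x \notin `]a, b[ -> cutoff n x = 0 /\ cutoff' n x = 0.
Proof.
rewrite -theta_gt0 -leNgt => h.
have h1 : n.+1%:R * theta x <= 1.
  by apply: (@le_trans _ _ 0) => //; rewrite mulr_ge0_le0.
by rewrite /cutoff /cutoff' smoothstep_le1// smoothstep'_le1// mul0r.
Qed.

(** Where the cut-off does not vanish, theta exceeds 1 / (n + 1), and this keeps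
    the point away from a and b. *)
Lemma cutoff_off0 n : exists c d, [/\ a < c, d < b & off0 c d (cutoff n)].
Proof.
(* theta is at most b - a times the distance to either end point *)
pose e := (n.+1%:R * (b - a))^-1.
have ba : 0 < b - a by rewrite subr_gt0.
have n0 : 0 < n.+1%:R :> R by rewrite ltr0n.
have e0 : 0 < e by rewrite invr_gt0 mulr_gt0.
exists (a + e), (b - e); split; [lra|lra|].
move=> x xn; have [xab|xab] := boolP (x \in `]a, b[); last first.
  by have [] := cutoff_off n xab.
apply: smoothstep_le1; rewrite leNgt; apply: contra xn => h.
have [h1 h2] := theta_le xab.
have key y : theta x <= (b - a) * y -> e <= y.
  move=> hy; rewrite -[e]mulr1 /e ler_pdivrMl ?mulr_gt0// -mulrA.
  by apply: (le_trans (ltW h)); rewrite ler_pM2l.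
by rewrite in_itv/=; have := key _ h1; have := key _ h2; move=> *; apply/andP; split; lra.
Qed.

Lemma C1c_mul_cutoff f f' n : C1 f f' -> C1c `]a, b[ (fun x => f x * cutoff n x) /\
  derive1 (fun x => f x * cutoff n x) = (fun x => f' x * cutoff n x + f x * cutoff' n x).
Proof.
move=> hf; have hp := C1M hf (cutoff_C1 n); split; last exact: C1_derive1 hp.
have [c [d [ac db h]]] := cutoff_off0 n.
apply: (C1c_intro (c := c) (d := d) hp).
  by move=> x /h ->; rewrite mulr0.
move=> x /=; rewrite !in_itv/= => /andP[h1 h2].
by rewrite (lt_le_trans ac h1) (le_lt_trans h2 db).
Qed.

Lemma inv_cvg0 (k : R) : k / n.+1%:R @[n --> \oo] --> (0 : R).
Proof.
rewrite -[X in _ --> X](mulr0 k); apply: cvgM; first exact: cvg_cst.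
exact: cvg_harmonic.
Qed.

Lemma cutoff_cvg x : x \in `]a, b[ -> cutoff n x @[n --> \oo] --> (1 : R).
Proof.
rewrite -theta_gt0 => t0.
have H : 2 / theta x / n.+1%:R @[n --> \oo] --> (0 : R) by exact: inv_cvg0.
have H2 : 1 - cutoff n x @[n --> \oo] --> (0 : R).
  apply: (@squeeze_cvgr _ _ _ _ (fun=> 0) (fun n => 2 / theta x / n.+1%:R)) => //.
    near=> n; rewrite /cutoff; set s := _ * theta x.
    have /andP[h0 h1] := smoothstep_bound s.
    have n0 : 0 < n.+1%:R :> R by rewrite ltr0n.
    have s0 : 0 < s by rewrite mulr_gt0.
    rewrite subr_ge0 h1/= -mulrA -invfM (mulrC (theta x)) -/s ler_pdivlMr//.
    have [s1|s1] := leP s 1.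
      by rewrite smoothstep_le1// subr0 mul1r (le_trans s1)// ler1n.
    by rewrite mulrC; have /andP[] := smoothstep_compl s1.
  exact: cvg_cst.
have -> : (fun n => cutoff n x) = (fun n => 1 - (1 - cutoff n x)).
  by apply/funext => n; ring.
rewrite -[X in _ --> X](subr0 (1 : R)); apply: cvgB => //; exact: cvg_cst.
Unshelve. all: by end_near. Qed.

(** The term f cutoff' is the error in the derivative when f is approximated by
    f cutoff. The vanishing of f at the end points compensates the growth of
    cutoff' there. The first bound serves for domination, the second one for
    pointwise convergence to 0. *)
Lemma mul_cutoff'_bound f (C : R) : (forall x, x \in `]a, b[ -> `|f x| <= C * theta x) ->
  forall n x, x \in `]a, b[ ->
  `|f x * cutoff' n x| <= 2 * C * (b - a) /\
  `|f x * cutoff' n x| <= 2 * C * (b - a) / theta x / n.+1%:R.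
Proof.
move=> hf n x xab; have t0 : 0 < theta x by rewrite theta_gt0.
have n0 : 0 < n.+1%:R :> R by rewrite ltr0n.
set s := n.+1%:R * theta x; have s0 : 0 < s by rewrite mulr_gt0.
have [h1 h2] := smoothstep'_bound (ltW s0).
have C0 : 0 <= C.
  by have := le_trans (normr_ge0 _) (hf x xab); rewrite pmulr_lge0.
have k0 : 0 <= C * (b - a) by rewrite mulr_ge0// subr_ge0 ltW.
have key : `|f x * cutoff' n x| * s <= 2 * C * (b - a).
  rewrite /cutoff' -/s (normrM (f x)) (normrM (smoothstep' s)) (normrM n.+1%:R).
  rewrite (ger0_norm h1) normr_nat.
  have l : `|a + b - 2 * x| <= b - a.
    by move: xab; rewrite in_itv/= => /andP[? ?]; rewrite ler_norml; apply/andP; split; lra.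
  have -> : `|f x| * (smoothstep' s * (n.+1%:R * `|a + b - 2 * x|)) * s =
     (`|f x| * n.+1%:R) * (`|a + b - 2 * x| * (s * smoothstep' s)) by ring.
  have fs : `|f x| * n.+1%:R <= C * s.
    by rewrite /s (mulrC n.+1%:R) mulrA ler_pM2r// hf.
  apply: (@le_trans _ _ ((C * s) * ((b - a) * (s * smoothstep' s)))).
    have ss : 0 <= s * smoothstep' s by rewrite mulr_ge0// ltW.
    apply: ler_pM => //; [exact: mulr_ge0|exact: ler_wpM2r].
  have -> : C * s * ((b - a) * (s * smoothstep' s)) =
    (C * (b - a)) * (s ^+ 2 * smoothstep' s) by ring.
  have -> : 2 * C * (b - a) = (C * (b - a)) * 2 by ring.
  exact: ler_wpM2l.
split; last by rewrite -mulrA -invfM (mulrC (theta x)) -/s ler_pdivlMr.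
have [s1|s1] := leP s 1; last first.
  apply: le_trans key; rewrite -[X in X <= _]mulr1 ler_wpM2l//; exact: ltW.
by rewrite /cutoff' -/s smoothstep'_le1// mul0r mulr0 normr0; nra.
Qed.

End cutoff.

(** * Weak derivatives *)
Section weak_derivative.
Context {R : realType}.
Notation mu := (@lebesgue_measure R).
Implicit Types f g h v phi : R -> R.

Definition ind (a b x : R) : R := \1_(`]a, b[%classic : set R) x.

Lemma indT (a b x : R) : x \in `]a, b[ -> ind a b x = 1.
Proof. by move=> h; rewrite /ind indicE mem_set. Qed.

Lemma indF (a b x : R) : x \notin `]a, b[ -> ind a b x = 0.
Proof. by move=> h; rewrite /ind indicE memNset//=; exact/negP. Qed.

Lemma measurable_ind (a b : R) : measurable_fun setT (ind a b).
Proof. exact: measurable_indic. Qed.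

Lemma ind_off0 (a b : R) f : off0 a b (fun x => f x * ind a b x).
Proof.
move=> x xn; rewrite indF ?mulr0//; apply: contra xn.
by rewrite !in_itv/= => /andP[/ltW -> /ltW ->].
Qed.

Lemma continuous_bounded_itv f (a b : R) : continuous f ->
  exists2 M : R, 0 < M & forall x, x \in `[a, b] -> `|f x| <= M.
Proof.
move=> cf; have : compact (f @` `[a, b]).
  apply: continuous_compact; [exact: continuous_subspaceT|exact: segment_compact].
move=> /compact_bounded [M [_ hM]]; exists (`|M| + 1); first by rewrite ltr_wpDl.
move=> x Sx; apply: hM; last by exists x.
by rewrite (le_lt_trans (ler_norm M))// ltrDl.
Qed.

Lemma ind_mul_bounded f (a b : R) : continuous f ->
  exists2 M : R, 0 < M & forall x, `|f x * ind a b x| <= M.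
Proof.
move=> cf; have [M M0 hM] := continuous_bounded_itv a b cf; exists M => // x.
have [xab|xab] := boolP (x \in `]a, b[).
  by rewrite indT// mulr1 hM//; apply: subset_itv_oo_cc xab.
by rewrite indF// mulr0 normr0 ltW.
Qed.

Lemma ind_mul_L2 f (a b : R) : continuous f -> (fun x => f x * ind a b x) \in 'L2.
Proof.
move=> cf; have [M M0 hM] := ind_mul_bounded a b cf.
apply: (@bounded_support_L2 _ _ a b M) => //; last exact: ind_off0.
by apply: measurable_funM; [exact: continuous_measurable_fun|exact: measurable_ind].
Qed.

Lemma ind_L2 (a b : R) : ind a b \in 'L2.
Proof.
have c1 : continuous (fun _ : R => 1 : R) by move=> x; exact: cvg_cst.
have := ind_mul_L2 a b c1.
rewrite (_ : (fun x => 1 * ind a b x) = ind a b)//.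
by apply/funext => x; rewrite mul1r.
Qed.

Lemma cutoff_in01 (a b : R) n x : 0 <= cutoff a b n x <= 1.
Proof. exact: smoothstep_bound. Qed.

Lemma C1c_cutoff (a b : R) n : a < b -> C1c `]a, b[ (cutoff a b n).
Proof.
move=> ab; have c1 : C1 (fun _ : R => 1 : R) (fun=> 0).
  by split=> [x|x]; [exact: is_derive_cst|exact: cvg_cst].
have [h _] := @C1c_mul_cutoff _ a b ab _ _ n c1.
by move: h; congr (C1c _ _); apply/funext => x; rewrite mul1r.
Qed.

Lemma L2norm_cutoff_ind (a b : R) : a < b ->
  L2norm (fun x => cutoff a b n x - ind a b x) @[n --> \oo] --> 0%E.
Proof.
move=> ab; apply: (@L2norm_dct _ _ a b 1).
- move=> n; apply: measurable_funB; last exact: measurable_ind.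
  exact: continuous_measurable_fun (C1_continuous (cutoff_C1 a b n)).
- move=> n x; have /andP[h1 h2] := cutoff_in01 a b n x.
  rewrite /ind indicE; case: (_ \in _) => /=; rewrite ler_norml; apply/andP; split; lra.
- move=> n x xn; have xn' : x \notin `]a, b[.
    by apply: contra xn; exact: subset_itv_oo_cc.
  by rewrite indF// subr0; have [] := cutoff_off ab n xn'.
- move=> x; have [xab|xab] := boolP (x \in `]a, b[).
    rewrite indT// -[X in _ --> X](subrr (1 : R)); apply: cvgB; last exact: cvg_cst.
    exact: cutoff_cvg.
  rewrite indF//; under eq_fun do rewrite subr0 (cutoff_off ab _ xab).1.
  exact: cvg_cst.
Qed.

(** The cut-offs of (a, b) are test functions that tend to its indicator in
    L^2. *)
Lemma ip_ind_eq0 h : h \in 'L2 -> (forall phi, C1c setT phi -> ip h phi = 0) ->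
  forall a b, ip (ind a b) h = 0.
Proof.
move=> hh h0 a b; have [ab|ab] := ltP a b; last first.
  rewrite /ip /Rintegral (eq_integral (cst 0%E)) ?integral0//.
  move=> x _; rewrite indF ?mul0r//.
  by rewrite in_itv/=; apply/negP => /andP[h1 h2]; have := lt_trans h1 h2; rewrite ltNge ab.
have hc n : C1c setT (cutoff a b n) by apply: C1c_sub (C1c_cutoff n ab).
have cv : ip (cutoff a b n) h @[n --> \oo] --> ip (ind a b) h.
  apply: cvg_ip => //; [by move=> n; have [] := C1c_L2 (hc n)|exact: ind_L2|].
  exact: L2norm_cutoff_ind.
have {}cv : (0 : R) @[n --> \oo] --> ip (ind a b) h.
  move: cv; rewrite (_ : (fun n => ip (cutoff a b n) h) = fun=> 0)//.
  by apply/funext => n; rewrite ipC h0.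
by rewrite -(cvg_lim (@Rhausdorff R) cv) lim_cst.
Qed.

Lemma L2_locally_integrable h : h \in 'L2 -> locally_integrable setT h.
Proof.
move=> hh; split; [exact: L2_measurable hh|exact: openT|] => K _ cK.
have mK := compact_measurable cK.
have i2 : mu.-integrable K (EFin \o (fun x => h x * h x)).
  by apply: (@integrableS _ _ _ mu setT) => //; exact: L2_ip_integrable.
have i1 : mu.-integrable K (EFin \o (fun=> 1 : R)).
  by apply: continuous_compact_integrable => // x; exact: cvg_cst.
have /integrableP[_] := @integrableD _ _ _ mu K (compact_measurable cK) _ _ i1 i2.
apply: le_lt_trans; apply: ge0_le_integral => //.
- apply/measurable_EFinP; apply: measurableT_comp => //.
  by apply: measurable_funTS; exact: L2_measurable hh.
- apply: measurableT_comp => //; apply/measurable_EFinP.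
  apply: measurable_funTS; apply: measurable_funD => //.
  by apply: measurable_funM; exact: L2_measurable hh.
- move=> x _ /=; rewrite lee_fin [leRHS]ger0_norm; last first.
    by rewrite addr_ge0// -expr2 sqr_ge0.
  by have := sqr_ge0 (`|h x| - 1); rewrite sqrrB real_normK ?num_real//; nra.
Qed.

(** Fundamental lemma of the calculus of variations. The integrals of h over
    intervals are inner products with indicators, so they vanish; by Lebesgue's
    differentiation theorem h is almost everywhere the derivative of its
    indefinite integral, which is 0. *)
Lemma L2_orth_C1c_eq0 h : h \in 'L2 -> (forall phi, C1c setT phi -> ip h phi = 0) ->
  {ae mu, forall x, h x = 0}.
Proof.
move=> hh h0; have lh := L2_locally_integrable hh.
have mh := L2_measurable hh.
(* the indefinite integral needs a finite base point: h is only locally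
   integrable, so half-lines starting at - n are treated one by one *)
have H (n : nat) : {ae mu, forall x, - n%:R < x -> h x = 0}.
  have ih (y : R) : mu.-integrable [set` `]- n%:R, y]] (EFin \o h).
    have cK := @segment_compact R (- n%:R) y.
    apply: (@integrableS _ _ _ mu `[- n%:R, y]%classic) => //.
      by apply: subset_itvr; rewrite bnd_simp.
    apply/integrableP; split; last by have [_ _ /(_ _ (@subsetT _ _) cK)] := lh.
    by apply/measurable_EFinP; apply: measurable_funTS.
  have := FTC1 ih lh; set F := fun x : R => Rintegral _ _ _.
  have F0 : F = cst 0.
    apply/funext => x; rewrite /F -Rintegral_itv_bndo_bndc; last first.
      by apply: integrableS (ih x) => //; apply: subset_itvl; rewrite bnd_simp.
    rewrite Rintegral_mkcond -[RHS](ip_ind_eq0 hh h0 (- n%:R) x).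
    apply: eq_Rintegral => y _; rewrite patchE /ind indicE.
    by case: ifP => _; rewrite ?mul1r ?mul0r.
  move=> H; apply: (ae_imp H) => x hx nx.
  have [//|_ <-] := hx.
  by rewrite F0 derive1_cst.
have /ae_foralln H2 := H.
apply: (ae_imp H2) => x hx; apply: (hx (Num.bound `|x|)).
rewrite ltrNl (le_lt_trans _ (archi_boundP _))//.
by rewrite -normrN ler_norm.
Qed.

Lemma is_wderiv_unique v g1 g2 : is_wderiv v g1 -> is_wderiv v g2 ->
  {ae mu, forall x, g1 x = g2 x}.
Proof.
move=> [_ h1 e1] [_ h2 e2].
have h : {ae mu, forall x, g1 x - g2 x = 0}.
  apply: L2_orth_C1c_eq0; first exact: L2B.
  move=> phi hphi; rewrite ipC ipBr//; last by have [] := C1c_L2 hphi.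
  rewrite ipC (ipC _ g2); apply/eqP; rewrite subr_eq0; apply/eqP/oppr_inj.
  by rewrite -[LHS]e1// -[RHS]e2.
by apply: (ae_imp h) => x /eqP; rewrite subr_eq0 => /eqP.
Qed.

Lemma wderivP v g : is_wderiv v g -> is_wderiv v (wderiv v).
Proof. by move=> h; rewrite /wderiv; apply: (@getPex _ [set g | is_wderiv v g]); exists g. Qed.

Lemma wderivE v g : is_wderiv v g -> {ae mu, forall x, wderiv v x = g x}.
Proof. by move=> h; exact: is_wderiv_unique (wderivP h) h. Qed.

Lemma is_wderiv_comb v g w h k : is_wderiv v g -> is_wderiv w h ->
  is_wderiv (fun x => v x + k * w x) (fun x => g x + k * h x).
Proof.
move=> [v2 g2 e1] [w2 h2 e2]; split; [exact/L2D/L2Z|exact/L2D/L2Z|].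
move=> phi hphi; have [p2 dp2] := C1c_L2 hphi.
rewrite -[LHS]/(ip _ _) -[X in _ = - X]/(ip _ _) !(ipC _ phi) ipC.
rewrite !ipDr ?L2Z// !ipZr//.
have := e1 _ hphi; have := e2 _ hphi; rewrite -!/(ip _ _) !(ipC _ phi) !(ipC _ (derive1 phi)).
by move=> -> ->; ring.
Qed.

Lemma is_wderiv_C1c phi : C1c setT phi -> is_wderiv phi (derive1 phi).
Proof.
move=> hp; have [p2 dp2] := C1c_L2 hp; split=> // psi hpsi.
exact: ip_ibp (C1c_C1 hp) hpsi.
Qed.

(** Extension by 0 creates no jump at a and b, hence no boundary term. *)
Lemma is_wderiv_ind f f' (a b : R) : a < b -> C1 f f' -> f a = 0 -> f b = 0 ->
  is_wderiv (fun x => f x * ind a b x) (fun x => f' x * ind a b x).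
Proof.
move=> ab hf fa fb; have cf := C1_continuous hf; have cf' := hf.2.
split; [exact: ind_mul_L2|exact: ind_mul_L2|] => phi hphi.
have mindE g : \int[mu]_x (g x * ind a b x) = \int[mu]_(x in `[a, b]) (g x * ind a b x).
  by apply: Rint_off0; exact: ind_off0.
have E g h : continuous g -> continuous h ->
    \int[mu]_x (g x * ind a b x * h x) = \int[mu]_(x in `[a, b]) (g x * h x).
  move=> cg ch.
  have igh : mu.-integrable `[a, b] (EFin \o (fun x => g x * h x)).
    apply: continuous_compact_integrable; first exact: segment_compact.
    by apply: continuous_subspaceT => x; apply: cvgM; [exact: cg|exact: ch].
  rewrite -Rintegral_itv_bndo_bndc; last first.
    by apply: integrableS igh => //; apply: subset_itvl; rewrite bnd_simp.
  rewrite -Rintegral_itv_obnd_cbnd; last first.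
    by apply: integrableS igh => //; apply: subset_itv_oo_cc.
  rewrite [RHS]Rintegral_mkcond; apply: eq_Rintegral => x _.
  rewrite patchE /ind indicE; case: ifP => _ /=; rewrite ?mulr0 ?mul0r//.
  by rewrite mulr1.
have cphi := C1_continuous (C1c_C1 hphi); have cdphi := (C1c_C1 hphi).2.
rewrite (E f _ cf cdphi) (E f' _ cf' cphi).
by apply: (Rint_ibp ab hf (C1c_C1 hphi)); rewrite ?fa ?fb mul0r.
Qed.

End weak_derivative.

(** * The space of H^1 functions with zero boundary values *)
Section H10_theory.
Context {R : realType}.
Notation mu := (@lebesgue_measure R).
Implicit Types f g h v w phi : R -> R.
Variables (a b : R).

Notation I := (ind a b).
(** The identity is not square integrable on the line; its restriction to (a, b)
    has the same inner products with the functions that vanish off (a, b). *)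
Definition Xab (x : R) : R := x * ind a b x.
Notation X := Xab.

Lemma Xab_L2 : X \in 'L2.
Proof. by apply: ind_mul_L2 => x; exact: cvg_id. Qed.

Lemma H10_wderiv v : H10 a b v -> is_wderiv v (wderiv v).
Proof. by move=> [_ _ [g hg] _]; exact: wderivP hg. Qed.

Lemma H10_L2 v : H10 a b v -> v \in 'L2.
Proof. by move=> /H10_wderiv[]. Qed.

Lemma H10_dL2 v : H10 a b v -> wderiv v \in 'L2.
Proof. by move=> /H10_wderiv[]. Qed.

Lemma H10_off v x : H10 a b v -> x \notin `]a, b[ -> v x = 0.
Proof. by move=> [_ h _ _]; exact: h. Qed.

Lemma C1c_oo_T phi : C1c `]a, b[ phi -> C1c setT phi.
Proof. exact: C1c_sub. Qed.

Lemma H10_ip_ind v : H10 a b v -> ip I v = \int[mu]_x v x.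
Proof.
move=> hv; apply: eq_Rintegral => x _; have [xab|xab] := boolP (x \in `]a, b[).
  by rewrite indT// mul1r.
by rewrite (H10_off hv xab) mulr0.
Qed.

(** Both sides are continuous for the H^1 norm, in which test functions are
    dense. The weak form of an equation is therefore checked on test functions
    only. *)
Lemma H10_density T1 T2 : T1 \in 'L2 -> T2 \in 'L2 ->
  (forall phi, C1c `]a, b[ phi -> ip T1 (derive1 phi) + ip T2 phi = 0) ->
  forall v, H10 a b v -> ip T1 (wderiv v) + ip T2 v = 0.
Proof.
move=> h1 h2 h v hv; have [_ _ _ [phi [hphi c1 c2]]] := hv.
have p n := C1c_L2 (C1c_oo_T (hphi n)).
have k1 := cvg_ip (fun n => (p n).1) (H10_L2 hv) h2 c1.
have k2 := cvg_ip (fun n => (p n).2) (H10_dL2 hv) h1 c2.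
have cv : ip (derive1 (phi n)) T1 + ip (phi n) T2 @[n --> \oo] -->
    ip (wderiv v) T1 + ip v T2 by exact: cvgD.
have E : (fun n => ip (derive1 (phi n)) T1 + ip (phi n) T2) = fun=> 0.
  by apply/funext => n /=; rewrite ipC (ipC _ T2) h.
rewrite E in cv; rewrite ipC (ipC T2) -[LHS](cvg_lim (@Rhausdorff R) cv).
by rewrite lim_cst.
Qed.

(** Any weak derivative may be used instead of the chosen one, because they agree
    almost everywhere. *)
Lemma H10_intro v g (phi : nat -> R -> R) : continuous v ->
  (forall x, x \notin `]a, b[ -> v x = 0) -> is_wderiv v g ->
  (forall n, C1c `]a, b[ (phi n)) ->
  L2norm (fun x => phi n x - v x) @[n --> \oo] --> 0%E ->
  L2norm (fun x => derive1 (phi n) x - g x) @[n --> \oo] --> 0%E ->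
  H10 a b v.
Proof.
move=> cv v0 hg hphi c1 c2; split=> //; first by exists g.
exists phi; split=> //.
rewrite (_ : (fun n => _) = fun n => L2norm (fun x => derive1 (phi n) x - g x))//.
apply/funext => n; have [_ dp] := C1c_L2 (C1c_oo_T (hphi n)).
have [_ g2 _] := hg; have [_ w2 _] := wderivP hg.
apply: L2norm_ae; [by apply: L2_measurable; exact: L2B|by apply: L2_measurable; exact: L2B|].
by apply: (ae_imp (wderivE hg)) => x ->.
Qed.

Lemma ind_mul_continuous f : a < b -> continuous f -> f a = 0 -> f b = 0 ->
  continuous (fun x => f x * I x).
Proof.
move=> ab cf fa fb.
(* as f vanishes at a and b, extending it by 0 is composing it with the
   projection of the line onto [a, b] *)
rewrite (_ : (fun x => _) = (fun x => f (Num.max a (Num.min b x)))).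
  move=> x; apply: continuous_comp; last exact: cf.
  apply: continuous_max; first exact: cvg_cst.
  by apply: continuous_min; [exact: cvg_cst|exact: cvg_id].
apply/funext => x; have [xab|] := boolP (x \in `]a, b[).
  rewrite indT// mulr1; move: xab; rewrite in_itv/= => /andP[ax xb].
  by rewrite (min_r (ltW xb)) (max_r (ltW ax)).
move=> xab; rewrite indF// mulr0; move: xab; rewrite in_itv/= negb_and -!leNgt.
move=> /orP[xa|bx].
  by rewrite (min_r (le_trans xa (ltW ab))) max_l.
by rewrite min_l// max_r ?ltW.
Qed.

(** The mean value theorem from either end point bounds |f| by M (x - a) and by
    M (b - x); weighting these by b - x and x - a and adding bounds (b - a) |f| by
    2 M theta. *)
Lemma C1_bounded_by_theta f f' : a < b -> C1 f f' -> f a = 0 -> f b = 0 ->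
  exists C, forall x, x \in `]a, b[ -> `|f x| <= C * theta a b x.
Proof.
move=> ab [df cf'] fa fb; have [M M0 hM] := continuous_bounded_itv a b cf'.
have cf : continuous f by exact: (C1_continuous (conj df cf')).
have mvt x y : x < y -> x \in `[a, b] -> y \in `[a, b] -> `|f y - f x| <= M * (y - x).
  move=> xy xab yab.
  have [|c cxy ->] := @MVT _ f f' x y xy; first exact: continuous_subspaceT.
  rewrite normrM (gtr0_norm (_ : 0 < y - x)) ?subr_gt0// ler_pM2r ?subr_gt0//.
  apply: hM; move: cxy xab yab; rewrite !in_itv/= => /andP[c1 c2] /andP[a1 _] /andP[_ b1].
  by rewrite (le_trans a1 (ltW c1)) (le_trans (ltW c2) b1).
exists (2 * M / (b - a)) => x; rewrite in_itv/= => /andP[ax xb].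
have ba : 0 < b - a by rewrite subr_gt0.
have xab : x \in `[a, b] by rewrite in_itv/= !ltW.
have h1 : `|f x| <= M * (x - a).
  have := mvt a x ax; rewrite fa subr0; apply=> //; by rewrite in_itv/= lexx ltW.
have h2 : `|f x| <= M * (b - x).
  have := mvt x b xb xab; rewrite fb sub0r normrN; apply; by rewrite in_itv/= lexx ltW.
rewrite mulrAC ler_pdivlMr// /theta.
have k1 : `|f x| * (b - x) <= M * (x - a) * (b - x) by rewrite ler_pM2r ?subr_gt0.
have k2 : `|f x| * (x - a) <= M * (b - x) * (x - a) by rewrite ler_pM2r ?subr_gt0.
have -> : `|f x| * (b - a) = `|f x| * (b - x) + `|f x| * (x - a) by ring.
have -> : 2 * M * ((x - a) * (b - x)) = M * (x - a) * (b - x) + M * (b - x) * (x - a) by ring.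
exact: lerD.
Qed.

(** The products f cutoff are test functions with derivative
    f' cutoff + f cutoff', and dominated convergence applies to both terms by
    [mul_cutoff'_bound]. *)
Lemma H10_ind f f' : a < b -> C1 f f' -> f a = 0 -> f b = 0 ->
  H10 a b (fun x => f x * I x).
Proof.
move=> ab hf fa fb.
have hp n := C1c_mul_cutoff ab n hf.
have cf := C1_continuous hf; have cf' := hf.2.
have [C hC] := C1_bounded_by_theta ab hf fa fb.
have bnd := mul_cutoff'_bound ab hC.
have [M M0 hM] := ind_mul_bounded a b cf.
have [M' M'0 hM'] := ind_mul_bounded a b cf'.
have ba : 0 < b - a by rewrite subr_gt0.
have off x : x \notin `[a, b] -> x \notin `]a, b[.
  by apply: contra; exact: subset_itv_oo_cc.
have mI g : continuous g -> measurable_fun setT (fun x => g x * I x).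
  by move=> cg; apply: measurable_funM; [exact: continuous_measurable_fun|exact: measurable_ind].
have key1 g (N : R) n x : (forall x, `|g x * I x| <= N) ->
    `|g x * cutoff a b n x - g x * I x| <= N.
  move=> hN; have [xab|xab] := boolP (x \in `]a, b[).
    have := hN x; rewrite indT// mulr1 => h.
    rewrite -[X in _ - X]mulr1 -mulrBr normrM; apply: le_trans h.
    rewrite -[X in _ <= X]mulr1 ler_wpM2l//.
    have /andP[h1 h2] := cutoff_in01 a b n x.
    by rewrite ler_norml; apply/andP; split; lra.
  rewrite (cutoff_off ab n xab).1 indF// !mulr0 subrr normr0.
  exact: le_trans (normr_ge0 _) (hN x).
have cvg1 g x : g x * cutoff a b n x - g x * I x @[n --> \oo] --> (0 : R).
  have [xab|xab] := boolP (x \in `]a, b[).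
    rewrite indT// -[X in _ --> X](subrr (g x * 1)).
    apply: cvgB; last exact: cvg_cst.
    by apply: cvgM; [exact: cvg_cst|exact: cutoff_cvg].
  rewrite indF//; under eq_fun do rewrite (cutoff_off ab _ xab).1 !mulr0 subrr.
  exact: cvg_cst.
apply: (@H10_intro _ (fun x => f' x * I x) (fun n x => f x * cutoff a b n x)).
- exact: ind_mul_continuous.
- by move=> x xab; rewrite indF// mulr0.
- exact: is_wderiv_ind.
- by move=> n; have [] := hp n.
- apply: (@L2norm_dct _ _ a b M) => //.
  + move=> n; apply: measurable_funB; last exact: mI.
    by apply: continuous_measurable_fun; exact: C1_continuous (C1c_C1 (hp n).1).
  + by move=> n x; exact: key1.
  + by move=> n x /off xab; rewrite (cutoff_off ab n xab).1 indF// !mulr0 subrr.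
- apply: (@L2norm_dct _ _ a b (M' + 2 * C * (b - a))) => //.
  + move=> n; apply: measurable_funB; last exact: mI.
    by apply: continuous_measurable_fun; case: (hp n) => -[].
  + move=> n x; rewrite (hp n).2 addrAC; apply: le_trans (ler_normD _ _) _.
    apply: lerD; first exact: key1.
    have [xab|xab] := boolP (x \in `]a, b[); first exact: (bnd n x xab).1.
    rewrite (cutoff_off ab n xab).2 mulr0 normr0.
    (* the midpoint only serves to see that the bound is nonnegative *)
    have xm : (a + b) / 2 \in `]a, b[ by rewrite in_itv/=; apply/andP; split; lra.
    exact: le_trans (normr_ge0 _) (bnd 0%N _ xm).1.
  + move=> n x /off xab; rewrite (hp n).2.
    by rewrite (cutoff_off ab n xab).1 (cutoff_off ab n xab).2 indF// !mulr0 addr0 subrr.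
  + move=> x; rewrite (_ : (fun n => _) = (fun n =>
      (f' x * cutoff a b n x - f' x * I x) + f x * cutoff' a b n x)); last first.
      by apply/funext => n; rewrite (hp n).2 addrAC.
    rewrite -[X in _ --> X](addr0 (0 : R)); apply: cvgD; first exact: cvg1.
    have [xab|xab] := boolP (x \in `]a, b[); last first.
      by under eq_fun do rewrite (cutoff_off ab _ xab).2 mulr0; exact: cvg_cst.
    apply/cvgr0Pnorm_le => e e0.
    have := @inv_cvg0 R (2 * C * (b - a) / theta a b x).
    move=> /cvgr0Pnorm_le /(_ e e0); apply: filterS => n; apply: le_trans.
    apply: le_trans (bnd n x xab).2 _; exact: ler_norm.
Qed.

Lemma H10_addC1c v phi k : H10 a b v -> C1c `]a, b[ phi ->
  H10 a b (fun x => v x + k * phi x).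
Proof.
move=> hv hphi; have [cv v0 _ [psi [hpsi c1 c2]]] := hv.
have hp := is_wderiv_C1c (C1c_oo_T hphi).
have cphi := C1_continuous (C1c_C1 hphi).
have hc n := C1c_comb k (hpsi n) hphi.
apply: (@H10_intro _ (fun x => wderiv v x + k * derive1 phi x)
   (fun n x => psi n x + k * phi x)).
- by move=> x; apply: cvgD; [exact: cv|apply: cvgM; [exact: cvg_cst|exact: cphi]].
- move=> x xab; rewrite v0// (C1c_supp hphi); last exact/negP.
  by rewrite mulr0 addr0.
- exact: is_wderiv_comb (H10_wderiv hv) hp.
- by move=> n; have [] := hc n.
- rewrite (_ : (fun n => _) = (fun n => L2norm (fun x => psi n x - v x)))//.
  by apply/funext => n; congr L2norm; apply/funext => x; ring.
- rewrite (_ : (fun n => _) = (fun n => L2norm (fun x => derive1 (psi n) x - wderiv v x)))//.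
  apply/funext => n; congr L2norm; rewrite (hc n).2; apply/funext => x; ring.
Qed.

End H10_theory.

(** * The Euler-Lagrange equation of a minimiser *)
Section variational.
Context {R : realType}.
Notation mu := (@lebesgue_measure R).
Implicit Types f g h v w u phi : R -> R.
Variables (a b kappa alpha : R).

Notation I := (ind a b).
Notation X := (Xab a b).
Notation K := (kappa * cos alpha).
Notation S := (kappa * sin alpha).

(** The differential of the energy at u in the direction v. *)
Definition denergy u v : R :=
  ip (wderiv u) (wderiv v) + K * ip u v - S * ip X v.

Lemma energyE v g : H10 a b v -> is_wderiv v g ->
  energy kappa alpha v = 2^-1 * ip g g + K / 2 * ip v v - S * ip X v.
Proof.
move=> hv hg; have [v2 g2 _] := hg; have w2 := H10_dL2 hv.
have -> : ip g g = ip (wderiv v) (wderiv v).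
  have e := wderivE hg; have mg := L2_measurable g2; have mw := L2_measurable w2.
  by rewrite (ip_ae mw mg mw e) ipC (ip_ae mw mg mg e).
have X2 := Xab_L2 a b.
rewrite -(ipZr 2^-1 w2 w2) -(ipZr (K / 2) v2 v2) -(ipZr S X2 v2).
have i1 := L2_ip_integrable w2 (L2Z 2^-1 w2).
have i2 := L2_ip_integrable v2 (L2Z (K / 2) v2).
have i3 := L2_ip_integrable X2 (L2Z S v2).
rewrite /ip -RintegralD//.
have i12 : mu.-integrable setT
    (EFin \o (fun x => wderiv v x * (2^-1 * wderiv v x) + v x * (K / 2 * v x))).
  by have := @integrableD _ _ _ mu setT measurableT _ _ i1 i2; apply.
rewrite -RintegralB//; apply: eq_Rintegral => x _.
rewrite real_normK ?num_real// /Xab.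
have [xab|xab] := boolP (x \in `]a, b[); first by rewrite indT//; field.
by rewrite (H10_off hv xab); field.
Qed.

Lemma energy_addC1c w phi s : H10 a b w -> C1c `]a, b[ phi ->
  energy kappa alpha (fun x => w x + s * phi x) =
  energy kappa alpha w + s * denergy w phi +
    s ^+ 2 / 2 * (ip (derive1 phi) (derive1 phi) + K * ip phi phi).
Proof.
move=> hw hphi; have hw' := H10_wderiv hw.
have hp := is_wderiv_C1c (C1c_oo_T hphi).
rewrite (energyE (H10_addC1c s hw hphi) (is_wderiv_comb s hw' hp)).
rewrite (energyE hw hw') /denergy.
have [w2 dw2 _] := hw'; have [p2 dp2 _] := hp.
have -> : ip (wderiv w) (wderiv phi) = ip (wderiv w) (derive1 phi).
  rewrite ipC (ipC _ (derive1 phi)); apply: ip_ae; [| | |exact: wderivE].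
  - by have [_ h _] := wderivP hp; exact: L2_measurable.
  - exact: L2_measurable.
  - exact: L2_measurable.
have X2 := Xab_L2 a b.
rewrite (ip_sqD dw2 (L2Z s dp2)) (ip_sqD w2 (L2Z s p2)) (ipDr X2 w2 (L2Z s p2)).
rewrite !ipZr ?L2Z// ![ip (fun x => s * _ x) _]ipC !ipZr//.
by field.
Qed.

(** On the compact support of phi, the continuous function w has a positive lower
    bound. *)
Lemma C1c_variation_ge0 w phi : continuous w -> (forall x, 0 <= w x) ->
  (forall x, x \in `]a, b[ -> 0 < w x) -> C1c `]a, b[ phi ->
  exists2 d : R, 0 < d & forall s, `|s| <= d -> forall x, 0 <= w x + s * phi x.
Proof.
move=> cw w0 wpos hphi; have [_ _ cS SA] := hphi; set Q := closure _ in cS SA.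
have hQ : C1c Q phi by case: hphi => *; split.
have [M [M0 [_ _ phiM _]]] := C1c_bounded (C1c_oo_T hphi).
have cwV : {within Q, continuous (fun x => (w x)^-1)}.
  apply: continuous_in_subspaceT => x /set_mem Qx.
  by apply: cvgV; [rewrite gt_eqF// wpos//; exact: SA|exact: cw].
have /compact_bounded [N [_ hN]] := continuous_compact cwV cS.
pose N1 : R := `|N| + 1; have N10 : 0 < N1 by rewrite ltr_wpDl.
have lb x : Q x -> N1^-1 <= w x.
  move=> Qx; have wx : 0 < w x by rewrite wpos//; exact: SA.
  rewrite -[X in _ <= X]invrK lef_pV2 ?posrE ?invr_gt0//.
  have hb : `|(w x)^-1| <= N1.
    apply: hN; last by exists x.
    by rewrite (le_lt_trans (ler_norm N))// ltrDl.
  by rewrite gtr0_norm ?invr_gt0 in hb.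
exists (M * N1)^-1; first by rewrite invr_gt0 mulr_gt0.
move=> s hs x; have [Qx|nQ] := pselect (Q x); last first.
  by rewrite (C1c_supp hQ nQ) mulr0 addr0.
have : `|s * phi x| <= N1^-1.
  rewrite normrM; apply: le_trans (ler_pM (normr_ge0 _) (normr_ge0 _) hs (phiM x)) _.
  by rewrite invfM -mulrA mulrCA mulVf ?gt_eqF// mulr1.
rewrite ler_norml => /andP[h _]; have := lb x Qx; lra.
Qed.

(** The energy along the variation s phi changes by s F + s^2 Q / 2, which is
    nonnegative for all small s of either sign; hence F = 0. *)
Lemma argmin_denergy0 V0 w : is_argmin V0 kappa alpha a b w ->
  (forall x, x \in `]a, b[ -> 0 < w x) ->
  forall phi, C1c `]a, b[ phi -> ip I phi = 0 -> denergy w phi = 0.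
Proof.
move=> [[hw w0 wV] wmin] wpos phi hphi phi0.
have cw : continuous w by case: hw.
have [d d0 hd] := C1c_variation_ge0 cw w0 wpos hphi.
set F := denergy w phi.
set Q := ip (derive1 phi) (derive1 phi) + K * ip phi phi.
have key s : `|s| <= d -> 0 <= s * F + s ^+ 2 / 2 * Q.
  move=> sd; have h := H10_addC1c s hw hphi.
  have := wmin (fun x => w x + s * phi x).
  rewrite energy_addC1c// -/F -/Q => H.
  suff : competitor V0 a b (fun x => w x + s * phi x) by move=> /H; lra.
  split=> //; first exact: hd.
  have [p2 _] := C1c_L2 (C1c_oo_T hphi).
  rewrite -(H10_ip_ind h) ipDr ?L2Z//; [|exact: ind_L2|exact: H10_L2 hw].
  by rewrite ipZr//; [rewrite phi0 mulr0 addr0 (H10_ip_ind hw)|exact: ind_L2].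
apply: contrapT => /eqP F0.
(* test with s = - t F, where t is so small that |s| <= d and t Q < 1 *)
pose t := Num.min (d / (`|F| + 1)) (`|Q| + 1)^-1.
have t0 : 0 < t by rewrite lt_min divr_gt0 ?invr_gt0 ?ltr_wpDl.
have t1 : t * `|F| <= d.
  have : t <= d / (`|F| + 1) by rewrite ge_min lexx.
  rewrite ler_pdivlMr ?ltr_wpDl// mulrDr mulr1; lra.
have t2 : t * Q < 1.
  have : t <= (`|Q| + 1)^-1 by rewrite ge_min lexx orbT.
  rewrite -[X in _ <= X]mul1r ler_pdivlMr ?ltr_wpDl// mulrDr mulr1.
  have : t * Q <= t * `|Q| by rewrite ler_pM2l// ler_norm.
  lra.
have := key (- (t * F)); rewrite normrN normrM gtr0_norm// => /(_ t1).
have FF : 0 < F ^+ 2 by rewrite exprn_even_gt0.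
have -> : - (t * F) * F + (- (t * F)) ^+ 2 / 2 * Q =
  (t * F ^+ 2) * (t * Q / 2 - 1) by field.
have tF : 0 < t * F ^+ 2 by exact: mulr_gt0.
rewrite pmulr_rge0// => h; lra.
Qed.

(** Weak form of - u'' + K u = S x + lam on (a, b), where lam is the multiplier of
    the volume constraint. *)
Definition euler_lagrange lam u :=
  forall v, H10 a b v -> denergy u v = lam * ip I v.

Lemma denergy_C1c_EL lam u g : H10 a b u -> is_wderiv u g ->
  (forall phi, C1c `]a, b[ phi ->
    ip g (derive1 phi) + K * ip u phi - S * ip X phi = lam * ip I phi) ->
  euler_lagrange lam u.
Proof.
move=> hu hg h v hv; have [u2 g2 _] := hg.
have X2 := Xab_L2 a b; have I2 := ind_L2 a b.
pose T2 x := K * u x - S * X x - lam * I x.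
have T22 : T2 \in 'L2 by apply: L2B (L2B (L2Z _ u2) (L2Z _ X2)) (L2Z _ I2).
have E p : p \in 'L2 -> ip T2 p = K * ip u p - S * ip X p - lam * ip I p.
  move=> p2; rewrite ipC (ipBr p2 (L2B (L2Z _ u2) (L2Z _ X2)) (L2Z _ I2)).
  rewrite (ipBr p2 (L2Z _ u2) (L2Z _ X2)) !ipZr//.
  by rewrite (ipC p u) (ipC p X) (ipC p I).
have := H10_density g2 T22 _ hv; rewrite E ?(H10_L2 hv)// /denergy => H.
have -> : ip (wderiv u) (wderiv v) = ip g (wderiv v).
  apply: ip_ae; [| | |exact: wderivE].
  - exact: L2_measurable (H10_dL2 hu).
  - exact: L2_measurable.
  - exact: L2_measurable (H10_dL2 hv).
suff : ip g (wderiv v) + (K * ip u v - S * ip X v - lam * ip I v) = 0 by lra.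
apply: H => phi hphi; have [p2 _] := C1c_L2 (C1c_oo_T hphi).
by rewrite E//; have := h _ hphi; lra.
Qed.

(** For a test function chi of nonzero integral, subtracting a multiple of chi from
    any other one gives integral 0, so the multiplier is read off from chi. Such
    a chi exists: otherwise, by density, w would have integral 0 as well, instead
    of V0. *)
Lemma argmin_EL V0 w : 0 < V0 -> is_argmin V0 kappa alpha a b w ->
  (forall x, x \in `]a, b[ -> 0 < w x) -> exists lam, euler_lagrange lam w.
Proof.
move=> V00 hmin wpos; have [[hw w0 wV] _] := hmin.
have X2 := Xab_L2 a b; have I2 := ind_L2 a b; have w2 := H10_L2 hw.
have dw2 := H10_dL2 hw.
have dE phi : C1c `]a, b[ phi -> denergy w phi =
    ip (wderiv w) (derive1 phi) + K * ip w phi - S * ip X phi.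
  move=> hphi; have hp := is_wderiv_C1c (C1c_oo_T hphi); rewrite /denergy.
  congr (_ + _ - _); rewrite ipC (ipC _ (derive1 phi)).
  have [_ p2 _] := wderivP hp; have [_ dp2] := C1c_L2 (C1c_oo_T hphi).
  by apply: ip_ae; [exact: L2_measurable..|exact: wderivE].
have [[chi [hchi chi0]]|nochi] := pselect (exists chi, C1c `]a, b[ chi /\ ip I chi <> 0).
  exists (denergy w chi / ip I chi).
  apply: (denergy_C1c_EL hw (H10_wderiv hw)) => phi hphi.
  have [hpsi dpsi] := C1c_comb (- (ip I phi / ip I chi)) hphi hchi.
  have [p2 dp2] := C1c_L2 (C1c_oo_T hphi).
  have [c2 dc2] := C1c_L2 (C1c_oo_T hchi).
  have := argmin_denergy0 hmin wpos hpsi.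
  rewrite (dE _ hpsi) dpsi (dE _ hchi) !ipDr ?L2Z// !ipZr//.
  rewrite mulNr divfK ?subrr; last exact/eqP.
  move=> /(_ erefl) H; apply/eqP; rewrite -subr_eq0; apply/eqP; rewrite -[RHS]H.
  rewrite [_ / ip I chi * _]mulrAC -[_ * _ / ip I chi]mulrA.
  move: (ip (wderiv w) (derive1 phi)) (ip w phi) (ip X phi) (ip I phi / ip I chi)
    (ip (wderiv w) (derive1 chi)) (ip w chi) (ip X chi) => x1 x2 x3 x4 x5 x6 x7.
  ring.
have z0 : (fun=> 0 : R) \in ('L2 : pred (R -> R)).
  have := L2Z 0 I2; rewrite (_ : (fun x => 0 * I x) = fun=> 0)//.
  by apply/funext => x; rewrite mul0r.
have := @H10_density _ a b (fun=> 0) I z0 I2 _ _ hw.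
have E p : ip (fun=> 0) p = 0.
  by rewrite /ip /Rintegral (eq_integral (cst 0%E)) ?integral0// => x _; rewrite mul0r.
rewrite E add0r (H10_ip_ind hw) wV => H; exfalso.
have : V0 = 0.
  apply: H => phi hphi; rewrite E add0r.
  by apply: contrapT => h; apply: nochi; exists phi.
by move=> V0e; rewrite V0e ltxx in V00.
Qed.

Lemma continuous_ae_eq0 f : continuous f -> {ae mu, forall x, f x = 0} ->
  forall x, f x = 0.
Proof.
move=> cf [N [mN N0 sub]] x; apply: contrapT => /eqP fx.
have : \forall y \near x, f y != 0 by exact: (cvgr_neq0 _ (cf x)).
move=> /nbhs_ballP[e /= e0 he].
have : (mu (ball x e) <= mu N)%E.
  apply: le_measure; rewrite ?inE//; first exact: measurable_ball.
  by move=> y /he fy; apply: sub => /= fy0; rewrite fy0 eqxx in fy.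
rewrite N0 lebesgue_measure_ball; last exact: ltW.
by rewrite lee_fin leNgt pmulrn_lgt0// e0.
Qed.

(** Exact second-order expansion at u: at a solution of the Euler-Lagrange
    equation the first-order term only sees the volume, which is the same. *)
Lemma energy_EL lam u w : H10 a b u -> H10 a b w -> euler_lagrange lam u ->
  ip I w = ip I u ->
  energy kappa alpha w = energy kappa alpha u +
    2^-1 * ip (fun x => wderiv w x - wderiv u x) (fun x => wderiv w x - wderiv u x) +
    K / 2 * ip (fun x => w x - u x) (fun x => w x - u x).
Proof.
move=> hu hw hEL e.
rewrite (energyE hu (H10_wderiv hu)) (energyE hw (H10_wderiv hw)).
rewrite (ip_sqB (H10_dL2 hw) (H10_dL2 hu)) (ip_sqB (H10_L2 hw) (H10_L2 hu)).
have := hEL _ hu; have := hEL _ hw; rewrite e /denergy.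
rewrite (ipC (wderiv w) (wderiv u)) (ipC w u) => h1 h2.
have := etrans h1 (esym h2).
move: (ip (wderiv w) (wderiv w)) (ip (wderiv u) (wderiv w)) (ip (wderiv u) (wderiv u))
  (ip w w) (ip u w) (ip u u) (ip X w) (ip X u) K S => x1 x2 x3 x4 x5 x6 x7 x8 x9 x0.
by clear => h; lra.
Qed.

Lemma EL_argmin V0 lam u : 0 <= K -> competitor V0 a b u -> euler_lagrange lam u ->
  is_argmin V0 kappa alpha a b u.
Proof.
move=> K0 hc hEL; split=> // w [hw w0 wV]; have [hu u0 uV] := hc.
rewrite (energy_EL hu hw hEL) ?H10_ip_ind ?wV//.
have := ip_ge0 (fun x => wderiv w x - wderiv u x).
have := mulr_ge0 K0 (ip_ge0 (fun x => w x - u x)).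
rewrite (mulrAC K 2^-1); move: (ip _ _) (K * ip _ _) (energy _ _ u) => x1 x2 x3; lra.
Qed.

(** Expanding the energy at u and at w and adding, the nonnegative second-order
    terms add up to 0. *)
Lemma EL_unique lam lam' u w : 0 < K -> H10 a b u -> H10 a b w ->
  euler_lagrange lam u -> euler_lagrange lam' w -> ip I u = ip I w -> w = u.
Proof.
move=> K0 hu hw eu ew e; have u2 := H10_L2 hu; have w2 := H10_L2 hw.
have h1 := energy_EL hu hw eu (esym e); have h2 := energy_EL hw hu ew e.
have z : ip (fun x => w x - u x) (fun x => w x - u x) = 0.
  have p1 := ip_ge0 (fun x => wderiv w x - wderiv u x).
  have p2 := ip_ge0 (fun x => wderiv u x - wderiv w x).
  have p3 := ip_ge0 (fun x => w x - u x).
  have p4 := ip_ge0 (fun x => u x - w x).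
  move: p1 p2 (mulr_ge0 (ltW K0) p3) (mulr_ge0 (ltW K0) p4) h1 h2.
  rewrite !(mulrAC K 2^-1).
  set x1 := ip _ _; set x2 := ip _ _; set x3 := K * _; set x4 := K * _.
  move=> q1 q2 q3 q4 h1 h2; have : x3 = 0.
    move: (energy _ _ u) (energy _ _ w) x1 x2 x3 x4 q1 q2 q3 q4 h1 h2.
    by move=> *; lra.
  by rewrite /x3 => /eqP; rewrite mulf_eq0 gt_eqF//= => /eqP.
have cd : continuous (fun x => w x - u x).
  by move=> x; apply: cvgB; [case: hw => + _ _ _; exact|case: hu => + _ _ _; exact].
apply/funext => x; apply/eqP; rewrite -subr_eq0; apply/eqP.
exact: (continuous_ae_eq0 cd (ip_eq0 (L2B w2 u2) z)).
Qed.

End variational.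

(** * Hyperbolic functions *)
Section hyperbolic.
Context {R : realType}.
Implicit Types x y s t : R.

Definition sh x : R := (expR x - expR (- x)) / 2.
Definition ch x : R := (expR x + expR (- x)) / 2.

Lemma is_derive_expRN x : is_derive x 1 (fun y : R => expR (- y)) (- expR (- x)).
Proof.
have h := @is_derive1_comp _ expR (fun y : R => - y) x _ _ (is_derive_expR _)
  (is_deriveNid x 1).
by apply: is_derive_eq h _; rewrite mulrN1.
Qed.

Lemma is_derive_sh x : is_derive x 1 sh (ch x).
Proof.
have h := is_derive_funM (is_derive_funD (is_derive_expR x)
  (is_deriveN (is_derive_expRN x))) (is_derive_fun_cst 2^-1 x).
by apply: is_derive_eq h _; rewrite /ch; ring.
Qed.

Lemma is_derive_ch x : is_derive x 1 ch (sh x).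
Proof.
have h := is_derive_funM (is_derive_funD (is_derive_expR x)
  (is_derive_expRN x)) (is_derive_fun_cst 2^-1 x).
by apply: is_derive_eq h _; rewrite /sh; ring.
Qed.

Lemma shN x : sh (- x) = - sh x. Proof. by rewrite /sh opprK; ring. Qed.
Lemma chN x : ch (- x) = ch x. Proof. by rewrite /ch opprK addrC. Qed.

Lemma sh0 : sh 0 = 0. Proof. by rewrite /sh oppr0 subrr mul0r. Qed.

Lemma ch2sh2 x : ch x ^+ 2 - sh x ^+ 2 = 1.
Proof.
have e : expR x * expR (- x) = 1 by rewrite -expRD subrr expR0.
by rewrite -e /ch /sh; field.
Qed.

Lemma ch_gt0 x : 0 < ch x.
Proof. by rewrite /ch divr_gt0// addr_gt0 ?expR_gt0. Qed.

Lemma ch_ge1 x : 1 <= ch x.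
Proof. by have := ch2sh2 x; have := ch_gt0 x; have := sqr_ge0 (sh x); nra. Qed.

Lemma normr_sh_lt_ch x : `|sh x| < ch x.
Proof.
rewrite ltr_norml /sh /ch; have := expR_gt0 x; have := expR_gt0 (- x).
by move=> *; apply/andP; split; lra.
Qed.

Lemma is_derive_within_continuous (f f' : R -> R) (a b : R) :
  (forall x, x \in `[a, b] -> is_derive x 1 f (f' x)) -> {within `[a, b], continuous f}.
Proof.
move=> df; apply: continuous_in_subspaceT => x /set_mem/= xab.
exact: is_derive_continuous (df x xab).
Qed.

Lemma mvt (f f' : R -> R) (a b : R) : a < b ->
  (forall x, x \in `[a, b] -> is_derive x 1 f (f' x)) ->
  exists2 c, c \in `]a, b[ & f b - f a = f' c * (b - a).
Proof.
move=> ab df.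
have h1 x : x \in `]a, b[ -> is_derive x 1 f (f' x).
  by move=> xab; apply: df; exact: subset_itv_oo_cc xab.
exact: (MVT ab h1 (is_derive_within_continuous df)).
Qed.

Lemma derive_gt0_lt (f f' : R -> R) (a b : R) : a < b ->
  (forall x, x \in `[a, b] -> is_derive x 1 f (f' x)) ->
  (forall x, x \in `]a, b[ -> 0 < f' x) -> f a < f b.
Proof.
move=> ab df f'0; have [c cab e] := mvt ab df.
by rewrite -subr_gt0 e mulr_gt0 ?subr_gt0// f'0.
Qed.

Lemma sh_gt x : 0 < x -> x < sh x.
Proof.
move=> x0; rewrite -subr_gt0.
have := @derive_gt0_lt (fun y => sh y + - y) (fun y => ch y + - 1) 0 x x0.
rewrite sh0 oppr0 addr0; apply.
  by move=> y _; apply: is_derive_funD (is_derive_sh y) (is_deriveNid y 1).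
move=> y; rewrite in_itv/= => /andP[y0 _].
have := ch2sh2 y; have := ch_gt0 y.
have : 0 < sh y.
  rewrite /sh divr_gt0// subr_gt0 ltr_expR; lra.
by move=> *; nra.
Qed.

Lemma sh_gt0 x : 0 < x -> 0 < sh x.
Proof. by move=> x0; apply: lt_trans (sh_gt x0). Qed.

Lemma ch_lt x y : 0 <= x -> x < y -> ch x < ch y.
Proof.
move=> x0 xy; apply: (@derive_gt0_lt ch sh) => // z.
  by move=> _; exact: is_derive_ch.
by rewrite in_itv/= => /andP[xz _]; apply: sh_gt0; apply: le_lt_trans xz.
Qed.

Lemma sh_lt_xch x : 0 < x -> sh x < x * ch x.
Proof.
move=> x0; rewrite -subr_gt0.
have := @derive_gt0_lt (fun y => y * ch y + - sh y)
  (fun y => (1 * ch y + y * sh y) + - ch y) 0 x x0.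
rewrite sh0 mul0r oppr0 addr0; apply.
  move=> y _; apply: is_derive_funD (is_deriveN (is_derive_sh y)).
  exact: is_derive_funM (is_derive_fun_id y) (is_derive_ch y).
move=> y; rewrite in_itv/= => /andP[y0 _].
by rewrite mul1r addrAC subrr add0r mulr_gt0// sh_gt0.
Qed.

(** The function s coth s - 1, through which the slopes of a drop depend on its
    length. *)
Definition rho s : R := s * ch s / sh s - 1.

Lemma rho_gt0 s : 0 < s -> 0 < rho s.
Proof.
by move=> s0; rewrite subr_gt0 ltr_pdivlMr ?sh_gt0// mul1r sh_lt_xch.
Qed.

Lemma rho_lt s : 0 < s -> rho s < s.
Proof.
move=> s0; have h := sh_gt0 s0; rewrite ltrBlDr ltr_pdivrMr//.
have : ch s - sh s = expR (- s) by rewrite /ch /sh; field.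
have e1 : expR (- s) < 1 by rewrite expR_lt1 oppr_lt0.
have := expR_gt0 (- s); have := sh_gt s0; nra.
Qed.

Lemma rho_ge s : 0 < s -> s - 1 <= rho s.
Proof.
move=> s0; have h := sh_gt0 s0; rewrite lerB// ler_pdivlMr// ler_pM2l//.
by have := normr_sh_lt_ch s; rewrite gtr0_norm// => /ltW.
Qed.

Lemma is_derive_rho s : 0 < s -> is_derive s 1 rho ((sh s * ch s - s) / sh s ^+ 2).
Proof.
move=> s0; have h := sh_gt0 s0.
have h0 : sh s != 0 by rewrite gt_eqF.
have h1 := is_derive_funM (is_derive_fun_id s) (is_derive_ch s).
have h2 := is_derive_funM h1 (is_deriveV h0 (is_derive_sh s)).
have h3 := is_derive_funD h2 (is_derive_fun_cst (- 1) s).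
apply: is_derive_eq h3 _; rewrite /GRing.scale/=.
have e := ch2sh2 s; have -> : sh s * ch s - s = sh s * ch s - s * (ch s ^+ 2 - sh s ^+ 2).
  by rewrite e mulr1.
by field.
Qed.

(** The numerator of the derivative is positive because sh s > s and ch s >= 1. *)
Lemma rho_lt_homo s t : 0 < s -> s < t -> rho s < rho t.
Proof.
move=> s0 st; apply: (@derive_gt0_lt rho (fun s => (sh s * ch s - s) / sh s ^+ 2)) => // x.
  by rewrite in_itv/= => /andP[h _]; apply: is_derive_rho; apply: lt_le_trans h.
rewrite in_itv/= => /andP[h _]; have x0 := lt_trans s0 h.
have h1 := sh_gt0 x0; rewrite divr_gt0 ?exprn_gt0// subr_gt0.
by have := ch_ge1 x; have := sh_gt x0; nra.
Qed.

Lemma rho_surj r : 0 < r -> exists2 s, 0 < s & rho s = r.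
Proof.
move=> r0; have rr : r <= r + 1 by rewrite lerDl.
(* rho r < r <= rho (r + 1) *)
have [||s] := @IVT _ rho r (r + 1) r rr.
- apply: (@is_derive_within_continuous _ (fun s => (sh s * ch s - s) / sh s ^+ 2)) => x.
  by rewrite in_itv/= => /andP[h _]; apply: is_derive_rho; apply: lt_le_trans h.
- rewrite ge_min le_max (ltW (rho_lt r0))/= orbC.
  have := @rho_ge (r + 1); rewrite addrK => -> //; exact: addr_gt0.
by rewrite in_itv/= => /andP[h _] e; exists s => //; apply: lt_le_trans h.
Qed.

(** If f x <= 0, the mean value theorem on [a, x] and on [x, b] gives a point where
    f' <= 0 followed by one where f' >= 0. Together with f' a >= 0 this makes f''
    nonpositive somewhere and nonnegative further to the right, against
    f''' < 0. *)
Lemma third_derivative_gt0 (f f1 f2 f3 : R -> R) (a b : R) :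
  (forall x, is_derive x 1 f (f1 x)) -> (forall x, is_derive x 1 f1 (f2 x)) ->
  (forall x, is_derive x 1 f2 (f3 x)) -> (forall x, f3 x < 0) ->
  f a = 0 -> f b = 0 -> 0 <= f1 a -> forall x, x \in `]a, b[ -> 0 < f x.
Proof.
move=> d1 d2 d3 f30 fa fb f1a x; rewrite in_itv/= => /andP[ax xb].
rewrite ltNge; apply/negP => fx.
have [c1] := mvt ax (fun x _ => d1 x); rewrite in_itv/= => /andP[ac1 c1x] e1.
have [c2] := mvt xb (fun x _ => d1 x); rewrite in_itv/= => /andP[xc2 c2b] e2.
have g1 : f1 c1 <= 0 by rewrite fa in e1; nra.
have g2 : 0 <= f1 c2 by rewrite fb in e2; nra.
have [c3] := mvt ac1 (fun x _ => d2 x); rewrite in_itv/= => /andP[ac3 c3c1] e3.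
have c12 : c1 < c2 by apply: lt_trans xc2.
have [c4] := mvt c12 (fun x _ => d2 x); rewrite in_itv/= => /andP[c1c4 c4c2] e4.
have g3 : f2 c3 <= 0 by nra.
have g4 : 0 <= f2 c4 by nra.
have c34 : c3 < c4 by apply: lt_trans c1c4.
have [c5 _ e5] := mvt c34 (fun x _ => d3 x).
have := f30 c5; nra.
Qed.

End hyperbolic.

(** * The linear boundary value problem on a symmetric interval *)
Section profile.
Context {R : realType}.
Implicit Types x y l : R.
Variables (k B : R).

(** The solution of - f'' + k^2 f = k^2 (B y + M) that vanishes at y = l and
    y = - l, written as the sum of its odd and even parts. *)
Definition prof M l y := B * (y - l * (sh (k * y) / sh (k * l))) +
  M * (1 - ch (k * y) / ch (k * l)).
Definition prof1 M l y := B * (1 - l * (k * ch (k * y) / sh (k * l))) -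
  M * (k * sh (k * y) / ch (k * l)).
Definition prof2 M l y := - (k ^+ 2 *
  (B * l * sh (k * y) / sh (k * l) + M * ch (k * y) / ch (k * l))).
Definition prof3 M l y := - (k ^+ 3 *
  (B * l * ch (k * y) / sh (k * l) + M * sh (k * y) / ch (k * l))).
Definition prim M l y := B * (y ^+ 2 / 2 - l * (ch (k * y) / (k * sh (k * l)))) +
  M * (y - sh (k * y) / (k * ch (k * l))).

Lemma is_derive_scaled (f f' : R -> R) y : (forall x : R, is_derive x 1 f (f' x)) ->
  is_derive y 1 (fun z => f (k * z)) (k * f' (k * y)).
Proof.
move=> df; have h := @is_derive1_comp _ f (fun z => k * z) y _ _ (df _)
  (is_derive_funZ k (is_derive_fun_id y)).
by apply: is_derive_eq h _; rewrite mulr1 mulrC.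
Qed.

Let dsh y := @is_derive_scaled sh ch y is_derive_sh.
Let dch y := @is_derive_scaled ch sh y is_derive_ch.

Lemma is_derive_prof M l y : is_derive y 1 (prof M l) (prof1 M l y).
Proof.
have h1 := is_derive_funZ l (is_derive_funM (dsh y) (is_derive_fun_cst (sh (k * l))^-1 y)).
have h2 := is_derive_funM (dch y) (is_derive_fun_cst (ch (k * l))^-1 y).
have h3 := is_derive_funZ B (is_derive_funD (is_derive_fun_id y) (is_deriveN h1)).
have h4 := is_derive_funZ M (is_derive_funD (is_derive_fun_cst 1 y) (is_deriveN h2)).
by apply: is_derive_eq (is_derive_funD h3 h4) _; rewrite /prof1; ring.
Qed.

Lemma is_derive_prof1 M l y : is_derive y 1 (prof1 M l) (prof2 M l y).
Proof.
have h1 := is_derive_funZ l (is_derive_funM (is_derive_funZ k (dch y))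
  (is_derive_fun_cst (sh (k * l))^-1 y)).
have h2 := is_derive_funM (is_derive_funZ k (dsh y)) (is_derive_fun_cst (ch (k * l))^-1 y).
have h3 := is_derive_funZ B (is_derive_funD (is_derive_fun_cst 1 y) (is_deriveN h1)).
have h4 := is_deriveN (is_derive_funZ M h2).
by apply: is_derive_eq (is_derive_funD h3 h4) _; rewrite /prof2; ring.
Qed.

Lemma is_derive_prof2 M l y : is_derive y 1 (prof2 M l) (prof3 M l y).
Proof.
have h1 := is_derive_funM (is_derive_funZ (B * l) (dsh y)) (is_derive_fun_cst (sh (k * l))^-1 y).
have h2 := is_derive_funM (is_derive_funZ M (dch y)) (is_derive_fun_cst (ch (k * l))^-1 y).
have h3 := is_deriveN (is_derive_funZ (k ^+ 2) (is_derive_funD h1 h2)).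
by apply: is_derive_eq h3 _; rewrite /prof3; ring.
Qed.

Hypotheses (k0 : 0 < k) (B0 : 0 < B).

Section fixed_length.
Variable l : R.
Hypothesis l0 : 0 < l.

Let kl0 : 0 < k * l. Proof. exact: mulr_gt0. Qed.
Let sh_neq0 : sh (k * l) != 0. Proof. by rewrite gt_eqF// sh_gt0. Qed.
Let ch_neq0 : ch (k * l) != 0. Proof. by rewrite gt_eqF// ch_gt0. Qed.
Let rho_neq0 : rho (k * l) != 0. Proof. by rewrite gt_eqF// rho_gt0. Qed.
Let k_neq0 : k != 0. Proof. by rewrite gt_eqF. Qed.

Lemma is_derive_prim M y : is_derive y 1 (prim M l) (prof M l y).
Proof.
have h0 := is_derive_funM (is_derive_funM (is_derive_fun_id y) (is_derive_fun_id y))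
  (is_derive_fun_cst 2^-1 y).
have h1 := is_derive_funZ l (is_derive_funM (dch y) (is_derive_fun_cst (k * sh (k * l))^-1 y)).
have h2 := is_derive_funM (dsh y) (is_derive_fun_cst (k * ch (k * l))^-1 y).
have h3 := is_derive_funZ B (is_derive_funD h0 (is_deriveN h1)).
have h4 := is_derive_funZ M (is_derive_funD (is_derive_fun_id y) (is_deriveN h2)).
by apply: is_derive_eq (is_derive_funD h3 h4) _; rewrite /prof; field; apply/and3P.
Qed.

Lemma prof_end M : prof M l l = 0 /\ prof M l (- l) = 0.
Proof.
rewrite /prof mulrN shN chN; split; field; exact/andP.
Qed.

Lemma prof_ode M y : - prof2 M l y + k ^+ 2 * prof M l y = k ^+ 2 * (B * y + M).
Proof. rewrite /prof2 /prof; field; exact/andP. Qed.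

(** The value of M for which the solution has integral V: the odd part integrates
    to 0 and the even part to 2 M (l - tanh (k l) / k). *)
Definition height (V : R) := V * k * ch (k * l) / (2 * sh (k * l) * rho (k * l)).

Lemma height_volume V : prim (height V) l l - prim (height V) l (- l) = V.
Proof.
have e : rho (k * l) = k * l * ch (k * l) / sh (k * l) - 1 by [].
have r0 := rho_neq0.
rewrite /prim !mulrN shN chN mulNr.
have -> : forall q z M, B * (l ^+ 2 / 2 - z) + M * (l - q) -
   (B * ((- l) ^+ 2 / 2 - z) + M * (- l - - q)) = 2 * M * (l - q).
  by move=> *; field.
have -> : l - sh (k * l) / (k * ch (k * l)) =
    sh (k * l) / (k * ch (k * l)) * rho (k * l).
  by rewrite e; field; exact/and3P.
by rewrite /height; field; apply/and4P.
Qed.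

Lemma slope_left V : prof1 (height V) l (- l) =
  V * k ^+ 2 / 2 / rho (k * l) - B * rho (k * l).
Proof.
have -> : prof1 (height V) l (- l) = height V * (k * sh (k * l) / ch (k * l)) -
    B * rho (k * l).
  by rewrite /prof1 mulrN shN chN /rho; field; exact/andP.
by rewrite /height; field; apply/and3P.
Qed.

Lemma slope_right V : prof1 (height V) l l =
  - (V * k ^+ 2 / 2 / rho (k * l)) - B * rho (k * l).
Proof.
have -> : prof1 (height V) l l = - (height V * (k * sh (k * l) / ch (k * l))) -
    B * rho (k * l).
  by rewrite /prof1 /rho; field; exact/andP.
by rewrite /height; field; apply/and3P.
Qed.

(** The value of M for which the left slope vanishes. *)
Let M0 := B * rho (k * l) * ch (k * l) / (k * sh (k * l)).

(** The third derivative is negative, because rho (k l) < k l and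
    |sinh| < cosh. *)
Lemma prof_M0_gt0 y : y \in `]- l, l[ -> 0 < prof M0 l y.
Proof.
apply: (third_derivative_gt0 (is_derive_prof M0 l) (is_derive_prof1 M0 l)
   (is_derive_prof2 M0 l)).
- move=> x; rewrite oppr_lt0.
  have -> : B * l * ch (k * x) / sh (k * l) + M0 * sh (k * x) / ch (k * l) =
    B / (k * sh (k * l)) * (k * l * ch (k * x) + rho (k * l) * sh (k * x)).
    by rewrite /M0; field; exact/and3P.
  have h1 := rho_gt0 kl0; have h2 := rho_lt kl0.
  have := normr_sh_lt_ch (k * x); rewrite ltr_norml => /andP[h3 h4].
  have := sh_gt0 kl0 => h5.
  have c0 : 0 < B / (k * sh (k * l)) by apply: divr_gt0 => //; exact: mulr_gt0.
  apply: mulr_gt0; [exact: exprn_gt0|apply: mulr_gt0 => //].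
  have alg (r s u c : R) : 0 < r -> r < s -> - c < u -> u < c -> 0 < s * c + r * u.
    by move=> *; nra.
  exact: alg.
- by have [] := prof_end M0.
- by have [] := prof_end M0.
- rewrite (_ : prof1 M0 l (- l) = 0)// /prof1 /M0 mulrN shN chN /rho.
  field; exact/and3P.
Qed.

(** Raising M above M0 adds a positive multiple of 1 - ch (k y) / ch (k l); and a
    nonnegative left slope means that M is at least M0. *)
Lemma prof_gt0 V y : 0 <= prof1 (height V) l (- l) -> y \in `]- l, l[ ->
  0 < prof (height V) l y.
Proof.
move=> p0 yl; apply: lt_le_trans (prof_M0_gt0 yl) _.
rewrite /prof lerD2l ler_wpM2r//.
  rewrite subr_ge0 ler_pdivrMr ?ch_gt0// mul1r.
  move: yl; rewrite in_itv/= => /andP[y1 y2].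
  have ce : ch (k * y) = ch (k * `|y|).
    by have [_|_] := ger0P y; rewrite ?mulrN ?chN.
  have yl : `|y| < l by rewrite ltr_norml y1 y2.
  by rewrite ce ltW// ch_lt ?mulr_ge0 ?ltr_pM2l// ltW.
have e1 : height V * (k * sh (k * l) / ch (k * l)) = V * k ^+ 2 / 2 / rho (k * l).
  by rewrite /height; field; exact/and3P.
have e2 : M0 * (k * sh (k * l) / ch (k * l)) = B * rho (k * l).
  by rewrite /M0; field; exact/and3P.
have c0 : 0 < k * sh (k * l) / ch (k * l) by rewrite divr_gt0 ?ch_gt0// mulr_gt0// sh_gt0.
rewrite -(ler_pM2r c0) e1 e2 -subr_ge0; by rewrite slope_left in p0.
Qed.

End fixed_length.
End profile.

(** * One-sided derivatives at the ends of the support *)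
Section one_sided.
Context {R : realType}.

Lemma ind_right_derivative (f : R -> R) (df a b : R) : a < b -> is_derive a 1 f df ->
  f a = 0 -> is_right_derivative (fun x => f x * ind a b x) a df.
Proof.
move=> ab /is_derive1_caratheodory[g [fg cg ga]] fa.
have h1 : g (a + h) @[h --> 0^'+] --> df.
  rewrite -ga; apply: cvg_at_right_filter.
  have h2 : a + h @[h --> (0 : R)] --> a.
    by rewrite -[X in _ --> X]addr0; apply: cvgD; [exact: cvg_cst|exact: cvg_id].
  exact: (cvg_comp _ _ h2 cg).
apply: cvg_trans h1; apply: near_eq_cvg; near=> h.
have h0 : 0 < h by [].
have hb : a + h < b.
  by rewrite -ltrBrDl; near: h; apply: nbhs_right_lt; rewrite subr_gt0.
rewrite fa mul0r subr0 indT ?mulr1; last by rewrite in_itv/= hb ltrDl h0.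
have := fg (a + h); rewrite fa subr0 => ->.
by rewrite addrAC subrr add0r mulrC mulfK// gt_eqF.
Unshelve. all: by end_near. Qed.

Lemma ind_left_derivative (f : R -> R) (df a b : R) : a < b -> is_derive b 1 f df ->
  f b = 0 -> is_left_derivative (fun x => f x * ind a b x) b df.
Proof.
move=> ab /is_derive1_caratheodory[g [fg cg ga]] fb.
have h1 : g (b + h) @[h --> 0^'-] --> df.
  rewrite -ga; apply: cvg_at_left_filter.
  have h2 : b + h @[h --> (0 : R)] --> b.
    by rewrite -[X in _ --> X]addr0; apply: cvgD; [exact: cvg_cst|exact: cvg_id].
  exact: (cvg_comp _ _ h2 cg).
apply: cvg_trans h1; apply: near_eq_cvg; near=> h.
have h0 : h < 0 by [].
have hb : a < b + h.
  rewrite -ltrBlDl; near: h; apply: nbhs_left_gt; rewrite subr_lt0//.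
rewrite fb mul0r subr0 indT ?mulr1; last by rewrite in_itv/= hb gtrDl h0.
have := fg (b + h); rewrite fb subr0 => ->.
by rewrite addrAC subrr add0r mulrC mulfK// lt_eqF.
Unshelve. all: by end_near. Qed.

Lemma right_derivative_unique (f : R -> R) (x p q : R) :
  is_right_derivative f x p -> is_right_derivative f x q -> p = q.
Proof. by move=> hp hq; apply: (cvg_unique _ hp hq). Qed.

Lemma left_derivative_unique (f : R -> R) (x p q : R) :
  is_left_derivative f x p -> is_left_derivative f x q -> p = q.
Proof. by move=> hp hq; apply: (cvg_unique _ hp hq). Qed.

Lemma right_derivative_ge0 (f : R -> R) (x p : R) : f x = 0 -> (forall y, 0 <= f y) ->
  is_right_derivative f x p -> 0 <= p.
Proof.
move=> fx f0 hp; apply: (cvgr_to_ge hp); near=> h.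
rewrite fx subr0 mulr_ge0// invr_ge0; apply: ltW.
by near: h; exact: nbhs_right_gt.
Unshelve. all: by end_near. Qed.

Lemma is_derive_shift_arg (f f' : R -> R) (m x : R) : (forall y : R, is_derive y 1 f (f' y)) ->
  is_derive x 1 (fun y => f (y - m)) (f' (x - m)).
Proof.
move=> df; have h := @is_derive1_comp _ f (fun z => z - m) x _ _ (df _)
  (is_derive_funD (is_derive_fun_id x) (is_derive_fun_cst (- m) x)).
by apply: is_derive_eq h _; rewrite addr0 mulr1.
Qed.

Lemma C1_shift_arg (f f' f'' : R -> R) (m : R) : (forall y : R, is_derive y 1 f (f' y)) ->
  (forall y : R, is_derive y 1 f' (f'' y)) ->
  C1 (fun y => f (y - m)) (fun y => f' (y - m)).
Proof.
move=> df df'; split=> x; first exact: is_derive_shift_arg.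
exact: is_derive_continuous (is_derive_shift_arg m x df').
Qed.

End one_sided.

(** * Drops, and their slopes at the contact points *)
Section drop.
Context {R : realType}.
Notation mu := (@lebesgue_measure R).
Variables (kappa alpha V0 : R).
Notation K := (kappa * cos alpha).
Notation S := (kappa * sin alpha).
Hypotheses (K0 : 0 < K) (S0 : 0 < S) (V00 : 0 < V0).

Let k := Num.sqrt K.
Let B := S / K.

Let k0 : 0 < k. Proof. by rewrite sqrtr_gt0. Qed.
Let B0 : 0 < B. Proof. exact: divr_gt0. Qed.
Let kc0 : (cos alpha != 0) && (kappa != 0).
Proof. by move: (lt0r_neq0 K0); rewrite mulf_eq0 negb_or andbC. Qed.
Let k2 : k ^+ 2 = K. Proof. by rewrite sqr_sqrtr// ltW. Qed.

Definition cap (l y : R) := prof (Num.sqrt K) (S / K) (height (Num.sqrt K) l V0) l y.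
Definition drop (l m x : R) := cap l (x - m) * ind (m - l) (m + l) x.
(** The slopes at the left and at the right contact point. *)
Definition pslope (l : R) := prof1 (Num.sqrt K) (S / K) (height (Num.sqrt K) l V0) l (- l).
Definition qslope (l : R) := prof1 (Num.sqrt K) (S / K) (height (Num.sqrt K) l V0) l l.

Section fixed.
Variables (l m : R).
Hypothesis l0 : 0 < l.

Let ab : m - l < m + l. Proof. by have := l0; lra. Qed.
Let M := height k l V0.
Let f (x : R) := prof k B M l (x - m).
Let f1 (x : R) := prof1 k B M l (x - m).
Let f2 (x : R) := prof2 k B M l (x - m).

Let c01 : C1 f f1.
Proof. exact: C1_shift_arg (is_derive_prof k B M l) (is_derive_prof1 k B M l). Qed.
Let c12 : C1 f1 f2.
Proof. exact: C1_shift_arg (is_derive_prof1 k B M l) (is_derive_prof2 k B M l). Qed.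

Let fa : f (m - l) = 0.
Proof. by rewrite /f addrAC subrr add0r (prof_end _ k0 l0 _).2. Qed.
Let fb : f (m + l) = 0.
Proof. by rewrite /f addrAC subrr add0r (prof_end _ k0 l0 _).1. Qed.

Lemma drop_H10 : H10 (m - l) (m + l) (drop l m).
Proof. exact: H10_ind ab c01 fa fb. Qed.

Lemma drop_volume : \int[mu]_x drop l m x = V0.
Proof.
have cf := C1_continuous c01.
have hF (x : R) := is_derive_shift_arg m x (is_derive_prim B k0 l0 M).
have cF : C1 (fun x : R => prim k B M l (x - m)) f by split=> //.
have ifab : mu.-integrable `[m - l, m + l] (EFin \o f).
  by apply: continuous_compact_integrable; [exact: segment_compact|exact: continuous_subspaceT].
have E := @continuous_FTC2 R f (fun x => prim k B M l (x - m)) (m - l) (m + l) ab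
  (continuous_subspaceT cf) (C1_derivable_oo_LR _ _ cF)
  (fun x _ => congr1 (fun g => g x) (C1_derive1 cF)).
rewrite -[RHS](@height_volume _ k B k0 l l0 V0) -/M.
have -> : prim k B M l l - prim k B M l (- l) = \int[mu]_(x in `[m - l, m + l]) f x.
  by rewrite /Rintegral E -EFinB/=; congr (prim _ _ _ _ _ - prim _ _ _ _ _); ring.
rewrite -Rintegral_itv_bndo_bndc; last first.
  by apply: integrableS ifab => //; apply: subset_itvl; rewrite bnd_simp.
rewrite -Rintegral_itv_obnd_cbnd; last first.
  by apply: integrableS ifab => //; apply: subset_itv_oo_cc.
rewrite [RHS]Rintegral_mkcond; apply: eq_Rintegral => x _.
by rewrite patchE /drop /ind indicE; case: ifP => _ /=; rewrite ?mulr0 ?mulr1.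
Qed.

(** In the variable y = x - m the right-hand side S x + lam reads S y + lam + S m,
    so the constant K M of the profile is lam + S m. *)
Lemma drop_EL : euler_lagrange (m - l) (m + l) kappa alpha (K * M - S * m) (drop l m).
Proof.
have hg := is_wderiv_ind ab c01 fa fb.
apply: (denergy_C1c_EL drop_H10 hg) => phi hphi.
have hT := C1c_oo_T hphi; have [p2 dp2] := C1c_L2 hT.
set I := ind _ _; set X := Xab _ _.
have I2 : I \in 'L2 := ind_L2 _ _; have X2 : X \in 'L2 := Xab_L2 _ _.
have u2 := H10_L2 drop_H10.
have off x : x \notin `]m - l, m + l[ -> phi x = 0 /\ derive1 phi x = 0.
  move=> /negP xn; split; first exact: C1c_supp hphi xn.
  exact: C1c_derive1_supp hphi xn.
have -> : ip (fun x => f1 x * I x) (derive1 phi) = ip f1 (derive1 phi).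
  apply: eq_Rintegral => x _; have [xab|/off[_ ->]] := boolP (x \in `]m - l, m + l[).
    by rewrite /I indT// mulr1.
  by rewrite !mulr0.
rewrite (ip_ibp c12 hT).
pose T x := K * drop l m x - (S * X x + (K * M - S * m) * I x).
have -> : ip f2 phi = ip T phi.
  apply: eq_Rintegral => x _; have [xab|/off[-> _]] := boolP (x \in `]m - l, m + l[).
    congr (_ * _); rewrite /T /drop /X /Xab /I indT// !mulr1.
    have := prof_ode B k0 l0 M (x - m); rewrite k2 -/(f2 x) -/(f x).
    rewrite -/(f x) /cap -/k -/B -/M -/(f x).
    have -> : K * (B * (x - m) + M) = S * (x - m) + K * M.
      by rewrite /B; field.
    by move=> e; lra.
  by rewrite !mulr0.
have T2 : (fun x => S * X x + (K * M - S * m) * I x) \in 'L2 by apply: L2D; exact: L2Z.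
rewrite (ipC T) /T (ipBr p2 (L2Z K u2) T2) (ipDr p2 (L2Z S X2) (L2Z _ I2)) !ipZr//.
rewrite (ipC phi X) (ipC phi I) (ipC phi (drop l m)).
move: (ip _ phi) (ip X phi) (ip I phi) => *; ring.
Qed.

Lemma drop_right_derivative : is_right_derivative (drop l m) (m - l) (pslope l).
Proof.
have -> : pslope l = f1 (m - l) by rewrite /f1 addrAC subrr add0r.
by apply: (ind_right_derivative ab) => //; case: c01.
Qed.

Lemma drop_left_derivative : is_left_derivative (drop l m) (m + l) (qslope l).
Proof.
have -> : qslope l = f1 (m + l) by rewrite /f1 addrAC subrr add0r.
by apply: (ind_left_derivative ab) => //; case: c01.
Qed.

Lemma drop_end : drop l m (m - l) = 0.
Proof. by rewrite /drop indF ?mulr0// in_itv/= ltxx. Qed.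

Lemma drop_pos x : 0 <= pslope l -> x \in `]m - l, m + l[ -> 0 < drop l m x.
Proof.
move=> p0 xab; rewrite /drop indT// mulr1; apply: prof_gt0 => //.
by move: xab; rewrite !in_itv/= => /andP[h1 h2]; apply/andP; split; lra.
Qed.

Lemma drop_ge0 x : 0 <= pslope l -> 0 <= drop l m x.
Proof.
move=> p0; have [xab|xab] := boolP (x \in `]m - l, m + l[).
  by apply: ltW; exact: drop_pos.
by rewrite /drop indF// mulr0.
Qed.

Lemma drop_support : 0 <= pslope l ->
  [set x | 0 < drop l m x] = `]m - l, m + l[%classic.
Proof.
move=> p0; apply/seteqP; split=> x /=; last exact: drop_pos.
by apply: contraTT => xab; rewrite /drop indF// mulr0 ltxx.
Qed.

Lemma drop_argmin : 0 <= pslope l ->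
  is_argmin V0 kappa alpha (m - l) (m + l) (drop l m).
Proof.
move=> p0; apply: (EL_argmin (ltW K0) _ drop_EL).
by split; [exact: drop_H10|move=> x; exact: drop_ge0|exact: drop_volume].
Qed.

(** Both functions solve the Euler-Lagrange equation with the same volume. Once w
    is the drop, its nonnegativity near the left contact point says that the slope
    there is nonnegative. *)
Lemma argmin_is_drop w : is_argmin V0 kappa alpha (m - l) (m + l) w ->
  [set x | 0 < w x] = `]m - l, m + l[%classic -> w = drop l m /\ 0 <= pslope l.
Proof.
move=> hmin supp.
have wpos x : x \in `]m - l, m + l[ -> 0 < w x.
  by move=> xab; have : [set x | 0 < w x] x by rewrite supp.
have [lam hlam] := argmin_EL V00 hmin wpos; have [[hw w0 wV] _] := hmin.
have wE : w = drop l m.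
  apply: (EL_unique K0 drop_H10 hw drop_EL hlam).
  by rewrite (H10_ip_ind drop_H10) (H10_ip_ind hw) drop_volume wV.
split=> //; apply: (right_derivative_ge0 drop_end _ drop_right_derivative).
by rewrite -wE.
Qed.

End fixed.

Lemma pslopeE l : 0 < l -> pslope l = V0 * K / 2 / rho (k * l) - B * rho (k * l).
Proof. by move=> l0; rewrite /pslope slope_left// -/k k2. Qed.

Lemma qslopeE l : 0 < l -> qslope l = - (V0 * K / 2 / rho (k * l)) - B * rho (k * l).
Proof. by move=> l0; rewrite /qslope slope_right// -/k k2. Qed.

(** With r = rho (k l) and A = V0 K / 2, the slopes are A / r - B r and
    - A / r - B r, whose squares differ by 4 A B. *)
Lemma slopes_sq l : 0 < l -> qslope l ^+ 2 = pslope l ^+ 2 + 2 * V0 * S.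
Proof.
move=> l0; rewrite pslopeE// qslopeE//.
have r0 : rho (k * l) != 0 by rewrite gt_eqF// rho_gt0// mulr_gt0.
move: (rho _) r0 => r r0; rewrite /B; field.
by rewrite r0 andbT.
Qed.

Lemma qslope_lt0 l : 0 < l -> qslope l < 0.
Proof.
move=> l0; rewrite qslopeE//; have r0 : 0 < rho (k * l) by rewrite rho_gt0// mulr_gt0.
have : 0 < V0 * K / 2 / rho (k * l) by rewrite !divr_gt0// mulr_gt0.
have := mulr_gt0 B0 r0; lra.
Qed.

Lemma pslope_decr l l' : 0 < l -> l < l' -> pslope l' < pslope l.
Proof.
move=> l0 ll; have l'0 := lt_trans l0 ll; rewrite !pslopeE//.
have r0 : 0 < rho (k * l) by rewrite rho_gt0// mulr_gt0.
have rr : rho (k * l) < rho (k * l') by rewrite rho_lt_homo ?mulr_gt0// ltr_pM2l.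
have A0 : 0 < V0 * K / 2 by rewrite divr_gt0// mulr_gt0.
have h1 : (rho (k * l'))^-1 < (rho (k * l))^-1 by rewrite ltf_pV2 ?posrE// (lt_trans r0).
have h2 : B * rho (k * l) < B * rho (k * l') by rewrite ltr_pM2l.
have h3 : V0 * K / 2 / rho (k * l') < V0 * K / 2 / rho (k * l) by rewrite ltr_pM2l.
lra.
Qed.

Lemma pslope_surj P : 0 <= P -> exists2 l, 0 < l & pslope l = P.
Proof.
move=> P0; have A0 : 0 < V0 * K / 2 by rewrite divr_gt0// mulr_gt0.
set A := V0 * K / 2 in A0.
have d0 : 0 <= P ^+ 2 + 4 * A * B by have := B0; have := sqr_ge0 P; nra.
pose D := Num.sqrt (P ^+ 2 + 4 * A * B).
have D2 : D ^+ 2 = P ^+ 2 + 4 * A * B by rewrite sqr_sqrtr.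
have DP : P < D.
  have DD : 0 <= D by exact: sqrtr_ge0.
  have AB0 := mulr_gt0 A0 B0.
  by rewrite ltNge; apply/negP => h; nra.
(* (D - P) / (2 B) is the positive root r of A / r - B r = P *)
have r0 : 0 < (D - P) / (2 * B) by rewrite divr_gt0 ?subr_gt0// mulr_gt0.
have [s s0 es] := rho_surj r0.
exists (s / k); first exact: divr_gt0.
have ks : k * (s / k) = s by rewrite mulrC divfK// gt_eqF.
rewrite pslopeE ?divr_gt0// ks es -/A.
have DP0 : D - P != 0 by rewrite subr_eq0 gt_eqF.
have eA : A = (D ^+ 2 - P ^+ 2) / (4 * B) by rewrite D2; field; rewrite gt_eqF.
rewrite eA; field; by rewrite DP0 andbT gt_eqF.
Qed.

End drop.

(** * Uniform dependence of a drop on its length and position *)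
Section uniform_convergence.
Context {R : realType}.
Variables (kappa alpha V0 : R).
Notation K := (kappa * cos alpha).
Notation S := (kappa * sin alpha).
Hypotheses (K0 : 0 < K) (S0 : 0 < S) (V00 : 0 < V0).
Let k := Num.sqrt K.
Let B := S / K.
Let k0 : 0 < k. Proof. by rewrite sqrtr_gt0. Qed.
Let B0 : 0 < B. Proof. exact: divr_gt0. Qed.
Notation drop := (drop kappa alpha V0).
Notation cap := (cap kappa alpha V0).

Definition clamp (l y : R) := Num.max (- l) (Num.min l y).

Lemma clamp_norm l y : 0 < l -> `|clamp l y| <= l.
Proof.
move=> l0; rewrite /clamp ler_norml le_max lexx/= ge_max ge_min lexx/= andbT.
by have := l0; lra.
Qed.

Lemma clamp_dist l l' y y' : `|clamp l y - clamp l' y'| <= `|l - l'| + `|y - y'|.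
Proof.
rewrite /clamp /Num.max /Num.min.
have := ler_norm (l - l'); have := ler_norm (l' - l); rewrite (distrC l' l).
have := ler_norm (y - y'); have := ler_norm (y' - y); rewrite (distrC y' y).
have := normr_ge0 (l - l'); have := normr_ge0 (y - y').
rewrite ler_norml => *; apply/andP; split; repeat case: ifPn; rewrite -?leNgt => *; lra.
Qed.

(** The profile vanishes at l and - l, so the extension by 0 is the composition with
    the projection onto [- l, l]. This removes the indicator, whose dependence on
    l and m is not uniformly continuous. *)
Lemma drop_clamp l m x : 0 < l -> drop l m x = cap l (clamp l (x - m)).
Proof.
move=> l0; have [e1 e2] := prof_end B k0 l0 (height k l V0).
rewrite /drop /clamp; have [xab|xab] := boolP (x \in `]m - l, m + l[).
  rewrite indT// mulr1; move: xab; rewrite in_itv/= => /andP[h1 h2].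
  by rewrite min_r ?max_r//; lra.
rewrite indF// mulr0; move: xab; rewrite in_itv/= negb_and -!leNgt => /orP[h|h].
  by rewrite min_r ?max_l//; lra.
by rewrite min_l ?max_r//; lra.
Qed.

Lemma drop_translate l m x : drop l m x = drop l 0 (x - m).
Proof.
rewrite /drop subr0; congr (_ * _); rewrite /ind !indicE; congr (_%:R).
congr nat_of_bool.
by apply/idP/idP; rewrite !inE/= !in_itv/= => /andP[h1 h2]; apply/andP; split; lra.
Qed.

Lemma hyperbolic_lip (L y y' : R) : `|y| <= L -> `|y'| <= L ->
  `|sh (k * y) - sh (k * y')| <= k * ch (k * L) * `|y - y'| /\
  `|ch (k * y) - ch (k * y')| <= k * ch (k * L) * `|y - y'|.
Proof.
wlog yy : y y' / y < y'.
  move=> H h1 h2; have [yy|yy|->] := ltgtP y y'; first exact: H.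
    by have := H _ _ yy h2 h1; rewrite distrC (distrC (ch _)) (distrC y).
  by rewrite !subrr normr0 mulr0.
rewrite !ler_norml => /andP[h1 h2] /andP[h3 h4].
have chL z : z \in `]y, y'[ -> ch (k * z) <= ch (k * L).
  rewrite in_itv/= => /andP[z1 z2].
  have -> : ch (k * z) = ch (k * `|z|) by have [_|_] := ger0P z; rewrite ?mulrN ?chN.
  have zL : `|z| <= L by rewrite ler_norml; apply/andP; split; lra.
  move: zL; rewrite le_eqVlt => /predU1P[->//|zL].
  by apply: ltW; apply: ch_lt; rewrite ?mulr_ge0 ?ltr_pM2l// ltW.
have d0 : 0 < y' - y by rewrite subr_gt0.
rewrite (distrC y) (gtr0_norm d0).
have [c1 c1y e1] := mvt yy (fun z _ => is_derive_scaled k z is_derive_sh).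
have [c2 c2y e2] := mvt yy (fun z _ => is_derive_scaled k z is_derive_ch).
rewrite -!ler_norml distrC e1 (distrC (ch _)) e2.
rewrite (normrM (k * _)) (normrM k) (normrM (k * _)) (normrM k) (gtr0_norm d0) (gtr0_norm k0).
rewrite (gtr0_norm (ch_gt0 _)) !ler_pM2r ?ler_pM2l//; split; first exact: chL.
exact: le_trans (ltW (normr_sh_lt_ch _)) (chL _ c2y).
Qed.

Let c1 (l : R) := l / sh (k * l).
Let M (l : R) := height k l V0.
Let c2 (l : R) := M l / ch (k * l).

(** For arguments in [- L, L] the hyperbolic functions are bounded by ch (k L) and
    Lipschitz with constant k ch (k L); the coefficients are compared separately. *)
Lemma cap_dist (L l l' y y' : R) : `|y| <= L -> `|y'| <= L ->
  `|cap l y - cap l' y'| <=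
    (B + B * `|c1 l'| * (k * ch (k * L)) + `|c2 l'| * (k * ch (k * L))) * `|y - y'|
    + (B * `|c1 l - c1 l'| + `|c2 l - c2 l'|) * ch (k * L) + `|M l - M l'|.
Proof.
move=> yL y'L; have [h1 h2] := hyperbolic_lip yL y'L.
have chL z : `|z| <= L -> `|ch (k * z)| <= ch (k * L) /\ `|sh (k * z)| <= ch (k * L).
  move=> zL; have -> : `|ch (k * z)| = ch (k * `|z|).
    by rewrite (gtr0_norm (ch_gt0 _)); have [_|_] := ger0P z; rewrite ?mulrN ?chN.
  have q : ch (k * `|z|) <= ch (k * L).
    move: zL; rewrite le_eqVlt => /predU1P[->//|zL].
    by apply: ltW; apply: ch_lt; rewrite ?mulr_ge0 ?ltr_pM2l// ltW.
  split=> //; apply: le_trans q; apply: ltW; apply: lt_le_trans (normr_sh_lt_ch _) _.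
  by have [_|_] := ger0P z; rewrite ?mulrN ?chN.
have [h3 h4] := chL _ yL.
have capE t z : cap t z = B * z - B * (c1 t * sh (k * z)) + M t - c2 t * ch (k * z).
  by rewrite /cap /prof -/k -/B -/(M t) /c1 /c2; ring.
have -> : cap l y - cap l' y' = B * (y - y') - B * (c1 l' * (sh (k * y) - sh (k * y')))
    - c2 l' * (ch (k * y) - ch (k * y'))
    - (B * ((c1 l - c1 l') * sh (k * y)) + (c2 l - c2 l') * ch (k * y)) + (M l - M l').
  by rewrite !capE; ring.
apply: le_trans (ler_normD _ _) _; rewrite lerD2r.
apply: le_trans (ler_normB _ _) _; apply: lerD.
  apply: le_trans (ler_normB _ _) _; rewrite mulrDl; apply: lerD; last first.
    by rewrite (normrM (c2 _)) -mulrA ler_wpM2l.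
  apply: le_trans (ler_normB _ _) _; rewrite mulrDl; apply: lerD.
    by rewrite (normrM B) (gtr0_norm B0).
  rewrite (normrM B) (normrM (c1 _)) (gtr0_norm B0) -(mulrA B) -(mulrA B) (ler_pM2l B0).
  by rewrite -(mulrA `|c1 l'|) ler_wpM2l.
apply: le_trans (ler_normD _ _) _; rewrite [X in _ <= X]mulrDl; apply: lerD.
  by rewrite (normrM B) (normrM (c1 l - _)) (gtr0_norm B0) -mulrA (ler_pM2l B0) ler_wpM2l.
by rewrite (normrM (c2 l - _)) ler_wpM2l.
Qed.

Lemma coefficients_cvg (l : R -> R) (l0 : R) : 0 < l0 -> l t @[t --> +oo] --> l0 ->
  [/\ c1 (l t) @[t --> +oo] --> c1 l0, c2 (l t) @[t --> +oo] --> c2 l0 &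
      M (l t) @[t --> +oo] --> M l0].
Proof.
move=> l00 cl; have kl0 : 0 < k * l0 by exact: mulr_gt0.
have ck : k * l t @[t --> +oo] --> k * l0 by apply: cvgM => //; exact: cvg_cst.
have csh : sh (k * l t) @[t --> +oo] --> sh (k * l0).
  exact: (continuous_cvg _ (is_derive_continuous (is_derive_sh (k * l0)))).
have cch : ch (k * l t) @[t --> +oo] --> ch (k * l0).
  exact: (continuous_cvg _ (is_derive_continuous (is_derive_ch (k * l0)))).
have crho : rho (k * l t) @[t --> +oo] --> rho (k * l0).
  exact: (continuous_cvg _ (is_derive_continuous (is_derive_rho kl0))).
have sh_neq0 : sh (k * l0) != 0 by rewrite gt_eqF// sh_gt0.
have ch_neq0 : ch (k * l0) != 0 by rewrite gt_eqF// ch_gt0.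
have rho_neq0 : rho (k * l0) != 0 by rewrite gt_eqF// rho_gt0.
have cM : M (l t) @[t --> +oo] --> M l0.
  apply: cvgM; first by apply: cvgM => //; exact: cvg_cst.
  apply: cvgV; first by apply: mulf_neq0 => //; apply: mulf_neq0 => //; rewrite pnatr_eq0.
  by apply: cvgM => //; apply: cvgM => //; exact: cvg_cst.
split=> //; first by apply: cvgM => //; exact: cvgV.
by apply: cvgM => //; exact: cvgV.
Qed.

Lemma drop_uniform_cvg (l m n : R -> R) (l0 : R) : 0 < l0 ->
  (\forall t \near +oo, 0 < l t) ->
  l t @[t --> +oo] --> l0 -> m t - n t @[t --> +oo] --> (0 : R) ->
  ereal_sup (range (fun x => `|drop (l t) (m t) x - drop l0 (n t) x|%:E))
    @[t --> +oo] --> 0%E.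
Proof.
move=> l00 lpos cl cm; have [k1 k2 k3] := coefficients_cvg l00 cl.
pose L := l0 + 1.
pose C := B + B * `|c1 l0| * (k * ch (k * L)) + `|c2 l0| * (k * ch (k * L)).
pose bound t := C * (`|l t - l0| + `|m t - n t|)
    + (B * `|c1 (l t) - c1 l0| + `|c2 (l t) - c2 l0|) * ch (k * L) + `|M (l t) - M l0|.
have d0 (f : R -> R) z : f t @[t --> +oo] --> z -> `|f t - z| @[t --> +oo] --> (0 : R).
  move=> cf; rewrite -(normr0 R); apply: cvg_norm.
  by rewrite -(subrr z); apply: cvgB => //; exact: cvg_cst.
have C0 : 0 <= C.
  have kc : 0 <= k * ch (k * L) by apply: ltW; apply: mulr_gt0 => //; exact: ch_gt0.
  apply: addr_ge0; last exact: mulr_ge0.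
  by apply: addr_ge0; [exact: ltW|apply: mulr_ge0 => //; apply: mulr_ge0 => //; exact: ltW].
have cb : bound t @[t --> +oo] --> (0 : R).
  have -> : (0 : R) = C * (0 + 0) + (B * 0 + 0) * ch (k * L) + 0 by ring.
  apply: cvgD; last exact: d0.
  apply: cvgD.
    apply: cvgM; first exact: cvg_cst.
    by apply: cvgD; [exact: d0|rewrite -(normr0 R); exact: cvg_norm].
  apply: cvgM; last exact: cvg_cst.
  apply: cvgD; last exact: d0.
  by apply: cvgM; [exact: cvg_cst|exact: d0].
apply: (@squeeze_cvge _ _ _ _ (fun=> 0%E) _ (fun t => (bound t)%:E)); last 2 first.
- exact: cvg_cst.
- by apply/fine_cvgP; split; [exact: nearW|exact: cb].
have lL : \forall t \near +oo, l t < L.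
  by apply: (cvgr_lt _ cl); rewrite /L ltrDl.
near=> t; apply/andP; split.
  apply: le_trans (ereal_sup_ubound _); last by exists 0.
  by rewrite lee_fin.
apply: ge_ereal_sup => _ [x _ <-]; rewrite lee_fin.
have lt0 : 0 < l t by near: t.
have ltL : l t < L by near: t.
rewrite !drop_clamp//.
apply: (le_trans (@cap_dist L _ _ _ _ _ _)).
- by apply: le_trans (clamp_norm _ lt0) _; exact: ltW.
- by apply: le_trans (clamp_norm _ l00) _; rewrite /L lerDl.
rewrite /bound !lerD2r ler_wpM2l//.
apply: le_trans (clamp_dist _ _ _ _) _; rewrite lerD2l.
by rewrite [X in `|X|](_ : _ = n t - m t) 1?distrC//; ring.
Unshelve. all: by end_near. Qed.

End uniform_convergence.

(** * Lipschitz functions with a sign condition on the derivative *)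
Section lipschitz_monotone.
Context {R : realType}.
Notation mu := (@lebesgue_measure R).
Implicit Types f : R -> R.

Definition half_lip f := exists2 C : R, 0 <= C &
  forall s t : R, 0 <= s -> 0 <= t -> `|f s - f t| <= C * `|s - t|.

Lemma half_lipP f : (exists k : R, k.-lipschitz_`[0, +oo[ f) -> half_lip f.
Proof.
move=> [k hk]; exists `|k| => // s t s0 t0.
have := hk (s, t); rewrite /= => h; apply: le_trans (h _) _.
  by split; rewrite /= in_itv/= ?s0 ?t0.
by rewrite ler_wpM2r// ler_norm.
Qed.

Lemma half_lipD f g : half_lip f -> half_lip g -> half_lip (fun t => f t + g t).
Proof.
move=> [C C0 hf] [D D0 hg]; exists (C + D); first exact: addr_ge0.
move=> s t s0 t0; have -> : f s + g s - (f t + g t) = (f s - f t) + (g s - g t) by ring.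
by rewrite mulrDl; apply: le_trans (ler_normD _ _) _; apply: lerD; [exact: hf|exact: hg].
Qed.

Lemma half_lipZ k f : half_lip f -> half_lip (fun t => k * f t).
Proof.
move=> [C C0 hf]; exists (`|k| * C); first exact: mulr_ge0.
by move=> s t s0 t0; rewrite -mulrBr normrM -mulrA ler_wpM2l// hf.
Qed.

Lemma half_lip_id : half_lip (fun t : R => t).
Proof. by exists 1 => // s t _ _; rewrite mul1r. Qed.

Lemma half_lip_cst k : half_lip (fun _ : R => k).
Proof. by exists 0 => // s t _ _; rewrite subrr normr0 mul0r. Qed.

Lemma half_lip_sqr f M : (forall t, 0 <= t -> `|f t| <= M) -> half_lip f ->
  half_lip (fun t => f t * f t).
Proof.
move=> fM [C C0 hf]; have M0 : 0 <= M := le_trans (normr_ge0 _) (fM 0 (lexx _)).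
exists ((M + M) * C); first by rewrite mulr_ge0// addr_ge0.
move=> s t s0 t0; have -> : f s * f s - f t * f t = (f s + f t) * (f s - f t) by ring.
rewrite normrM -mulrA ler_pM//; last exact: hf.
by apply: le_trans (ler_normD _ _) _; apply: lerD; exact: fM.
Qed.

Let len (U : set R) (s x : R) : R := fine (mu (U `&` `]s, x]%classic)).

Let len_fin (U : set R) (s x : R) : measurable U ->
  (mu (U `&` `]s, x]%classic) < +oo)%E.
Proof.
move=> mU; have mI : measurable (`]s, x]%classic : set R) by exact: measurable_itv.
apply: (@le_lt_trans _ _ (mu `]s, x]%classic)).
  by apply: le_measure; rewrite ?inE//; exact: measurableI.
by rewrite lebesgue_measure_itv/=; case: ifP => // _; rewrite -EFinD ltry.
Qed.

Let lenE (U : set R) (s x : R) : measurable U ->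
  (len U s x)%:E = mu (U `&` `]s, x]%classic).
Proof. by move=> mU; rewrite /len fineK// ge0_fin_numE// len_fin. Qed.

Let len_ge0 (U : set R) (s x : R) : 0 <= len U s x.
Proof. exact: fine_ge0. Qed.

Let len_add (U : set R) (s x y : R) : measurable U -> s <= x -> x <= y ->
  len U s y = len U s x + len U x y.
Proof.
move=> mU sx xy; apply/EFin_inj; rewrite EFinD !lenE//.
have mI (u v : R) : measurable (U `&` `]u, v]%classic).
  by apply: measurableI => //; exact: measurable_itv.
rewrite -measureU; [|exact: mI|exact: mI|].
  rewrite -setIUr; congr (mu (_ `&` _)).
  apply/seteqP; split=> z /=; rewrite !in_itv/=.
    by move=> /andP[h1 h2]; have [zx|zx] := leP z x; [left|right]; apply/andP.
  by move=> [|] /andP[h1 h2]; apply/andP; split; lra.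
apply/seteqP; split=> z //= [[_ +] [_ +]]; rewrite !in_itv/= => /andP[_ h1] /andP[h2 _].
lra.
Qed.

Let len_sub (U : set R) (x y : R) : measurable U -> x <= y ->
  `]x, y]%classic `<=` U -> len U x y = y - x.
Proof.
move=> mU xy sub; rewrite /len setIidr// lebesgue_measure_itv/=.
move: xy; rewrite le_eqVlt => /predU1P[->|xy]; first by rewrite ltxx subrr.
by rewrite lte_fin xy.
Qed.

Let len_le (U : set R) (s x : R) (e : R) : measurable U -> (mu U <= e%:E)%E -> len U s x <= e.
Proof.
move=> mU Ue; rewrite -lee_fin lenE//; apply: le_trans Ue.
apply: le_measure; rewrite ?inE//; apply: measurableI => //; exact: measurable_itv.
Qed.

(** Let x be the supremum of the points of [s, t] where g is at least g s. The lower
    bound on increments passes the inequality to x, and the step beyond x is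
    excluded unless x = t. *)
Lemma right_growth (g : R -> R) (C s t : R) : s <= t ->
  (forall x y, s <= x -> x <= y -> y <= t -> - (C * (y - x)) <= g y - g x) ->
  (forall x, s <= x -> x < t -> exists2 y, x < y & y <= t /\ g x <= g y) ->
  g s <= g t.
Proof.
move=> st lip step.
pose A := [set x | [/\ s <= x, x <= t & g s <= g x]].
have As : A s by split.
have hA : has_sup A by split; [exists s|exists t => x []].
have ub x : A x -> x <= sup A by move=> Ax; exact: (ub_le_sup hA.2 Ax).
have st1 : s <= sup A by exact: ub.
have st2 : sup A <= t by apply: ge_sup; [exists s|move=> x []].
have Asup : A (sup A).
  split=> //; apply/ler_addgt0Pl => e e0.
  pose d := e / (`|C| + 1); have C1 : 0 < `|C| + 1 by rewrite ltr_wpDl.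
  have d0 : 0 < d by exact: divr_gt0.
  have [x Ax xd] := sup_adherent d0 hA; have [sx xt gx] := Ax.
  have := lip x (sup A) sx (ub x Ax) st2 => h1.
  have xs := ub x Ax.
  have h2 : C * (sup A - x) <= (`|C| + 1) * d.
    apply: (@le_trans _ _ ((`|C| + 1) * (sup A - x))).
      by rewrite ler_wpM2r ?subr_ge0// (le_trans (ler_norm C))// lerDl.
    by rewrite ler_pM2l//; lra.
  have h3 : (`|C| + 1) * d = e by rewrite /d mulrC divfK// gt_eqF.
  lra.
have [ltt|] := ltP (sup A) t; last first.
  by move=> h; have [_ _] := Asup; rewrite (le_anti (_ : sup A <= t <= sup A))// st2.
have [y xy [yt gy]] := step _ st1 ltt.
have Ay : A y by case: Asup => _ _ h; split=> //; [exact: le_trans (ltW xy)|exact: le_trans gy].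
by have := ub y Ay; rewrite leNgt xy.
Qed.

(** Enclose the exceptional null set in an open set U of measure at most e and add
    to f the function C len U + e x, where C is the Lipschitz constant. Just to
    the right of every point the sum takes values at least as large: in U the
    term C len U makes up for any decrease of f, and outside U the derivative of
    f is nonnegative and e x gives room. So the sum is nondecreasing, and it differs from f by
    O(e). *)
Lemma half_lip_nondecreasing f : half_lip f ->
  {ae mu, forall t : R, 0 <= t -> exists2 d : R, is_derive t 1 f d & 0 <= d} ->
  forall s t : R, 0 <= s -> s <= t -> f s <= f t.
Proof.
move=> [C C0 hf] [N [mN N0 sub]] s t s0 st.
apply/ler_addgt0Pl => e' e'0.
pose e : R := e' / (C + (t - s) + 1).
have den : 0 < C + (t - s) + 1 by lra.
have e0 : 0 < e by exact: divr_gt0.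
have [U [oU NU UN]] : exists U : set R, [/\ open U, N `<=` U & (mu (U `\` N) < e%:E)%E].
  have Nfin : (mu N < +oo)%E by rewrite N0.
  exact: (lebesgue_regularity_outer mN Nfin e0).
have mU : measurable U by exact: open_measurable.
have muU : (mu U <= e%:E)%E.
  have -> : U = (U `\` N) `|` N.
    apply/seteqP; split=> z; last by case=> [[]//|/NU].
    by move=> Uz; have [Nz|Nz] := pselect (N z); [right|left].
  have h : (mu ((U `\` N) `|` N) <= mu (U `\` N) + mu N)%E.
    by apply: measureU2 => //; exact: measurableD.
  by apply: le_trans h _; rewrite N0 adde0 ltW.
pose g x := f x + C * len U s x + e * x.
have lenD x y : s <= x -> x <= y -> len U s y - len U s x = len U x y.
  by move=> sx xy; rewrite (len_add mU sx xy) addrAC subrr add0r.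
have gD x y : s <= x -> x <= y -> g y - g x = (f y - f x) + C * len U x y + e * (y - x).
  by move=> sx xy; rewrite -(lenD x y sx xy) /g; ring.
have flb x y : s <= x -> x <= y -> - (C * (y - x)) <= f y - f x.
  move=> sx xy; have x0 : 0 <= x by lra.
  have y0 : 0 <= y by lra.
  have := hf y x y0 x0; rewrite (ger0_norm (_ : 0 <= y - x)) ?subr_ge0//.
  by rewrite ler_norml => /andP[].
have gst : g s <= g t.
  apply: (@right_growth g C s t st).
    move=> x y sx xy _; rewrite gD//; apply: le_trans (flb x y sx xy) _.
    by rewrite -addrA lerDl addr_ge0// mulr_ge0// ?subr_ge0// ltW.
  move=> x sx xt; have [Ux|nUx] := pselect (U x).
    have [r /= r0 hr] : exists2 r : R, 0 < r & ball x r `<=` U.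
      by have := open_nbhs_nbhs (conj oU Ux); move=> /nbhs_ballP[r r0 hr]; exists r.
    pose y := Num.min t (x + r / 2).
    have xy : x < y by rewrite lt_min xt ltrDl divr_gt0.
    have yt : y <= t by rewrite ge_min lexx.
    have yr : y <= x + r / 2 by rewrite ge_min lexx orbT.
    exists y => //; split=> //; rewrite -subr_ge0 gD ?(ltW xy)//.
    rewrite (len_sub mU (ltW xy)); last first.
      move=> z /=; rewrite in_itv/= => /andP[h1 h2]; apply: hr.
      by rewrite /ball/= ltr_norml; apply/andP; split; lra.
    have := flb x y sx (ltW xy).
    have : 0 <= e * (y - x) by rewrite mulr_ge0 ?subr_ge0 ?ltW.
    lra.
  have x0 : 0 <= x by exact: le_trans sx.
  have [d dx d0] : exists2 d : R, is_derive x 1 f d & 0 <= d.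
    by apply: contrapT => h; apply/nUx/NU/sub => h'; apply/h/h'.
  have [q [fq cq qx]] := (is_derive1_caratheodory _ _ _).1 dx.
  have : \forall z \near x, - e < q z.
    by apply: (cvgr_gt _ cq); rewrite qx; lra.
  move=> /nbhs_ballP[r /= r0 hr].
  pose y := Num.min t (x + r / 2).
  have xy : x < y by rewrite lt_min xt ltrDl divr_gt0.
  have yt : y <= t by rewrite ge_min lexx.
  have yr : y <= x + r / 2 by rewrite ge_min lexx orbT.
  exists y => //; split=> //; rewrite -subr_ge0 gD ?(ltW xy)// fq.
  have /ltW qy : - e < q y.
    by apply: hr; rewrite /ball/= ltr_norml; apply/andP; split; lra.
  have h1 : - e * (y - x) <= q y * (y - x) by rewrite ler_pM2r ?subr_gt0.
  have h2 : 0 <= C * len U x y by exact: mulr_ge0.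
  lra.
have l1 : len U s t <= e by exact: len_le.
have l0 := len_ge0 U s s.
have h1 : C * len U s t <= C * e by exact: ler_wpM2l.
have h2 : 0 <= C * len U s s by exact: mulr_ge0.
have ee : e * (C + (t - s) + 1) = e' by rewrite /e divfK// gt_eqF.
move: gst; rewrite /g; nra.
Qed.

Lemma derive_local_max f (t d M : R) : 0 < t -> (forall s, 0 <= s -> f s <= M) ->
  f t = M -> is_derive t 1 f d -> d = 0.
Proof.
move=> t0 fM ft dt; have [q [fq cq qt]] := (is_derive1_caratheodory _ _ _).1 dt.
have [d0|d0|//] := ltgtP d 0; exfalso.
- have : \forall z \near t, q z < 0 by apply: (cvgr_lt _ cq); rewrite qt.
  move=> /nbhs_ballP[r /= r0 hr].
  pose z := Num.max 0 (t - r / 2).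
  have zt : z < t by rewrite gt_max t0 gtrDl oppr_lt0 divr_gt0.
  have z0 : 0 <= z by rewrite le_max lexx.
  have zr : t - r / 2 <= z by rewrite le_max lexx orbT.
  have qz : q z < 0 by apply: hr; rewrite /ball/= ltr_norml; apply/andP; split; lra.
  have := fq z; have := fM z z0; rewrite ft => h1 h2.
  have : 0 < q z * (z - t) by rewrite nmulr_rgt0// subr_lt0.
  lra.
- have : \forall z \near t, 0 < q z by apply: (cvgr_gt _ cq); rewrite qt.
  move=> /nbhs_ballP[r /= r0 hr].
  pose z := t + r / 2.
  have zt : t < z by rewrite ltrDl divr_gt0.
  have qz : 0 < q z by apply: hr; rewrite /ball/= /z ltr_norml; apply/andP; split; lra.
  have z0 : 0 <= z by lra.
  have := fq z; have := fM z z0; rewrite ft => h1 h2.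
  have : 0 < q z * (z - t) by rewrite mulr_gt0// subr_gt0.
  lra.
Qed.

(** Lyapunov argument: (l - l0)^2 is nonincreasing, and as long as it exceeds e^2 it
    decreases at a rate bounded away from 0, which cannot last forever. *)
Lemma dissipative_cvg (l : R -> R) (l0 M : R) : half_lip l ->
  (forall t : R, 0 <= t -> `|l t - l0| <= M) ->
  (forall e : R, 0 < e -> exists2 d : R, 0 < d &
    {ae mu, forall t : R, 0 <= t -> exists2 dl : R, is_derive t 1 l dl &
      (l t - l0) * dl <= 0 /\ (e <= `|l t - l0| -> (l t - l0) * dl <= - d)}) ->
  l t @[t --> +oo] --> l0.
Proof.
move=> lipl lM H; pose y t := l t - l0.
have lipy : half_lip y by apply: half_lipD lipl (half_lip_cst _).
have liph : half_lip (fun t => - 1 * (y t * y t)).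
  by apply: half_lipZ; apply: (half_lip_sqr (M := M)).
have dy (t dl : R) : is_derive t 1 l dl ->
    is_derive t 1 (fun t => - 1 * (y t * y t)) (- (2 * (y t * dl))).
  move=> hl; have h1 := is_derive_funD hl (is_derive_fun_cst (- l0) t).
  apply: is_derive_eq (is_derive_funZ (- 1) (is_derive_funM h1 h1)) _.
  by rewrite addr0 -/(y t); ring.
have mono s t : 0 <= s -> s <= t -> y t * y t <= y s * y s.
  move=> s0 st; have [d d0 hd] := H 1 ltr01.
  have := @half_lip_nondecreasing _ liph _ s t s0 st.
  rewrite !mulN1r lerN2; apply; apply: (ae_imp hd) => z hz z0.
  have [dl hdl [h1 _]] := hz z0; exists (- (2 * (y z * dl))); first exact: dy.
  by rewrite -/(y z) in h1; lra.
apply/cvgrPdist_lt => e e0.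
have [T T0 yT] : exists2 T, 0 <= T & `|y T| < e.
  have [d d0 hd] := H e e0; apply: contrapT => nT.
  have big t : 0 <= t -> e <= `|y t|.
    by move=> t0; rewrite leNgt; apply/negP => h; apply: nT; exists t.
  (* by this time a decrease at rate 2 d would have made the square negative *)
  pose T := y 0 * y 0 / d + 1.
  have T0 : 0 <= T by apply: addr_ge0 => //; apply: divr_ge0; [rewrite -expr2 sqr_ge0|exact: ltW].
  have lipg : half_lip (fun t => - 1 * (y t * y t) + - (2 * d) * t).
    by apply: half_lipD liph (half_lipZ _ half_lip_id).
  have := @half_lip_nondecreasing _ lipg _ 0 T (lexx _) T0.
  rewrite mulr0 addr0 !mulN1r => h; have : - (y 0 * y 0) <= - (y T * y T) + - (2 * d) * T.
    apply: h; apply: (ae_imp hd) => z hz z0.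
    have [dl hdl [_ h2]] := hz z0.
    exists (- (2 * (y z * dl)) + - (2 * d) * 1).
      by apply: is_derive_funD (dy _ _ hdl) (is_derive_funZ _ (is_derive_fun_id z)).
    by have := h2 (big z z0); rewrite -/(y z); lra.
  have dT : d * T = y 0 * y 0 + d by rewrite /T mulrDr mulr1 mulrC divfK// gt_eqF.
  have := sqr_ge0 (y T); rewrite expr2; have := sqr_ge0 (y 0); rewrite expr2; nra.
near=> t; rewrite distrC -/(y t).
have Tt : T <= t by near: t; apply: nbhs_pinfty_ge; exact: num_real.
apply: le_lt_trans yT; rewrite -ler_sqr ?nnegrE// !real_normK ?num_real// !expr2.
exact: mono.
Unshelve. all: by end_near. Qed.

End lipschitz_monotone.

(** * Motion of the half-length and of the midpoint *)
Section dynamics.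
Context {R : realType}.
Notation mu := (@lebesgue_measure R).
Variables (kappa alpha V0 beta : R).
Notation K := (kappa * cos alpha).
Notation S := (kappa * sin alpha).
Hypotheses (K0 : 0 < K) (S0 : 0 < S) (V00 : 0 < V0).
Notation drop := (drop kappa alpha V0).
Notation pslope := (pslope kappa alpha V0).
Notation qslope := (qslope kappa alpha V0).

Lemma pslope_le l l' : 0 < l -> l <= l' -> pslope l' <= pslope l.
Proof.
by move=> l0; rewrite le_eqVlt => /predU1P[->//|h]; exact/ltW/pslope_decr.
Qed.

Lemma argmin_nonempty a b w : is_argmin V0 kappa alpha a b w -> a < b.
Proof.
move=> [[hw _ wV] _]; rewrite ltNge; apply/negP => ba.
have w0 x : w x = 0.
  apply: (H10_off hw); rewrite in_itv/=; apply/negP => /andP[h1 h2]; lra.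
have : V0 = 0.
  rewrite -wV /Rintegral (eq_integral (cst 0%E)) ?integral0// => x _.
  by rewrite w0.
by move=> e; have := V00; rewrite e ltxx.
Qed.

Lemma ae_and2 (P Q : R -> Prop) : {ae mu, forall x, P x} -> {ae mu, forall x, Q x} ->
  {ae mu, forall x, P x /\ Q x}.
Proof.
move=> hP hQ; apply: (negligibleS _ (negligibleU hP hQ)) => x /= nPQ.
by have [Px|nPx] := pselect (P x); [right=> Qx; exact: nPQ|left].
Qed.

Lemma ae_neq0 : {ae mu, forall x : R, x != 0}.
Proof.
exists [set 0]; split=> //; first exact: lebesgue_measure_set1.
by move=> x /= /negP; rewrite negbK => /eqP.
Qed.

(** The contact points m - l and m + l have velocities dm - dl and dm + dl. The right
    slope is never 0, so the condition there is an equation. Where the left slope is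
    0, l is maximal among all half-lengths with a nonnegative slope, hence maximal
    in time, and dl = 0. *)
Lemma solution_is_drop u0 w :
  sliding_drop_solution V0 kappa alpha (fun=> beta) u0 w ->
  exists l m : R -> R, [/\ half_lip l, half_lip m,
    forall t : R, 0 <= t -> [/\ 0 < l t, 0 <= pslope (l t) & w ^~ t = drop (l t) (m t)] &
    {ae mu, forall t : R, 0 <= t -> exists dl dm : R,
      [/\ is_derive t 1 l dl, is_derive t 1 m dm,
          dm + dl = 2^-1 * pslope (l t) ^+ 2 + V0 * S - beta &
          dm - dl = beta - 2^-1 * pslope (l t) ^+ 2 \/
          [/\ pslope (l t) = 0, beta <= dm - dl & dl = 0]]}].
Proof.
move=> [a0 [b0 [_ [a [b [lipa lipb _ hmin hae]]]]]].
have {}lipa := half_lipP lipa; have {}lipb := half_lipP lipb.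
pose l t := 2^-1 * (b t + - 1 * a t); pose m t := 2^-1 * (a t + b t).
have aE t : m t - l t = a t by rewrite /m /l; field.
have bE t : m t + l t = b t by rewrite /m /l; field.
have hdrop (t : R) : 0 <= t -> [/\ 0 < l t, 0 <= pslope (l t) & w ^~ t = drop (l t) (m t)].
  move=> t0; have [supp harg] := hmin t t0.
  have lt0 : 0 < l t by have := argmin_nonempty harg; rewrite /l; lra.
  rewrite -aE -bE in supp harg.
  by have [h1 h2] := argmin_is_drop K0 V00 lt0 harg supp.
exists l, m; split=> //.
- by apply: half_lipZ; apply: half_lipD => //; exact: half_lipZ.
- by apply: half_lipZ; exact: half_lipD.
apply: (ae_imp (ae_and2 hae ae_neq0)) => t [ht tn0] t0.
have {tn0}tpos : 0 < t by rewrite lt_neqAle eq_sym tn0.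
have [da db [p [q [hp hq minp minq]]]] := ht t0; have [lt0 plt0 wE] := hdrop t t0.
have Da := derivableP da; rewrite -derive1E in Da.
have Db := derivableP db; rewrite -derive1E in Db.
have pE : p = pslope (l t).
  apply: (right_derivative_unique hp); rewrite wE -aE.
  exact: drop_right_derivative.
have qE : q = qslope (l t).
  apply: (left_derivative_unique hq); rewrite wE -bE.
  exact: drop_left_derivative.
set da' := derive1 a t in Da minp; set db' := derive1 b t in Db minq.
have Dl : is_derive t 1 l (2^-1 * (db' + - 1 * da')).
  exact: is_derive_funZ (is_derive_funD Db (is_derive_funZ (- 1) Da)).
have Dm : is_derive t 1 m (2^-1 * (da' + db')) by exact: is_derive_funZ (is_derive_funD Da Db).
exists (2^-1 * (db' + - 1 * da')), (2^-1 * (da' + db')).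
have -> : 2^-1 * (da' + db') + 2^-1 * (db' + - 1 * da') = db' by field.
have -> : 2^-1 * (da' + db') - 2^-1 * (db' + - 1 * da') = da' by field.
split=> //.
  have q0 : 0 < `|q| by rewrite normr_gt0 qE lt_eqF// qslope_lt0.
  have : - db' + 2^-1 * `|q| ^+ 2 - beta = 0.
    by move: minq; rewrite /Num.min; case: ifP => // _ e; rewrite e ltxx in q0.
  rewrite real_normK ?num_real// qE (slopes_sq V0 K0 lt0); lra.
move: minp; rewrite pE (ger0_norm plt0) /Num.min; case: ifP => h e; first by left; lra.
right; split=> //; first by move/negbT: h; rewrite -leNgt e expr0n/= mulr0 addr0; lra.
apply: (@derive_local_max R l t _ (l t)) => // s s0.
have [ls0 pls0 _] := hdrop s s0.
rewrite leNgt; apply/negP => ll.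
have := pslope_decr K0 S0 V00 lt0 ll; rewrite e; lra.
Qed.

(** The square root of a negative number is 0 here, so that one formula covers both
    regimes. *)
Definition wave_slope : R := Num.sqrt (2 * beta - V0 * S).
Definition wave_speed : R := if V0 * S < 2 * beta then 2^-1 * V0 * kappa * sin alpha
  else V0 * kappa * sin alpha - beta.

Lemma antitone_cvg (f : R -> R) (m : R) :
  (forall s t : R, 0 <= s -> s <= t -> f t <= f s) ->
  (forall t : R, 0 <= t -> m <= f t) -> exists z : R, f t @[t --> +oo] --> z.
Proof.
move=> anti lb; pose g t := - f (Num.max 0 t).
have ndg : nondecreasing_fun g.
  move=> s t st; rewrite lerN2; apply: anti; first by rewrite le_max lexx.
  by rewrite ge_max le_max lexx/= le_max st orbT.
have ub : has_ubound (range g).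
  exists (- m) => _ [t _ <-]; rewrite lerN2; apply: lb.
  by rewrite le_max lexx.
have cg := nondecreasing_cvgr ndg ub.
exists (- sup (range g)); apply: cvg_trans (cvgN cg).
by apply: near_eq_cvg; near=> t; rewrite /= /g opprK max_r.
Unshelve. all: by end_near. Qed.

(** The comparison of l' with (p^2 - P^2) / 2 in the direction of l0 makes l converge.
    The correction of m by the wave speed is nonincreasing; a lower bound comes from
    its being constant in the first regime, and from the velocity of the right
    contact point in the second one. *)
Lemma drop_dynamics (l m : R -> R) (l0 : R) : half_lip l -> half_lip m ->
  0 < l0 -> pslope l0 = wave_slope ->
  (forall t : R, 0 <= t -> 0 < l t /\ 0 <= pslope (l t)) ->
  {ae mu, forall t : R, 0 <= t -> exists dl dm : R,
      [/\ is_derive t 1 l dl, is_derive t 1 m dm,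
          dm + dl = 2^-1 * pslope (l t) ^+ 2 + V0 * S - beta &
          dm - dl = beta - 2^-1 * pslope (l t) ^+ 2 \/
          [/\ pslope (l t) = 0, beta <= dm - dl & dl = 0]]} ->
  l t @[t --> +oo] --> l0 /\
  exists z : R, m t - wave_speed * t @[t --> +oo] --> z.
Proof.
move=> lipl lipm l00 pl0 hpos hae.
(* L is the half-length at which the left slope vanishes, the largest possible
   one *)
have [L L0 pL] := pslope_surj K0 S0 V00 (lexx 0).
have lL (t : R) : 0 <= t -> l t <= L.
  move=> t0; have [lt0 plt0] := hpos t t0; rewrite leNgt; apply/negP => h.
  by have := pslope_decr K0 S0 V00 L0 h; rewrite pL; lra.
have P0 : 0 <= wave_slope by exact: sqrtr_ge0.
set P := wave_slope in pl0 P0.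
have key (t : R) dl dm : 0 <= t ->
    dm + dl = 2^-1 * pslope (l t) ^+ 2 + V0 * S - beta ->
    dm - dl = beta - 2^-1 * pslope (l t) ^+ 2 \/
      [/\ pslope (l t) = 0, beta <= dm - dl & dl = 0] ->
    (l t - l0) * dl <= (l t - l0) * (2^-1 * (pslope (l t) ^+ 2 - P ^+ 2)) /\
    dm <= wave_speed.
  move=> t0 e1 e2; have [lt0 plt0] := hpos t t0.
  rewrite /wave_speed /P /wave_slope; case: ifP => c.
    rewrite sqr_sqrtr; last lra.
    case: e2 => [e2|[e2 e3 e4]]; last by exfalso; rewrite e2 expr0n/= in e1; lra.
    have [dlE dmE] : dl = 2^-1 * (pslope (l t) ^+ 2 - (2 * beta - V0 * S)) /\
        dm = 2^-1 * (V0 * S).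
      clear -e1 e2; move: (pslope (l t) ^+ 2) (V0 * S) e1 e2 => p2 vs e1 e2.
      by split; lra.
    by split; [rewrite dlE|rewrite dmE !mulrA].
  have c' : 2 * beta <= V0 * S by move/negbT: c; rewrite -leNgt.
  have Pz : P = 0 by rewrite /P /wave_slope ler0_sqrtr// subr_le0.
  rewrite -[Num.sqrt _]/P Pz expr0n/= subr0.
  have ll0 : l t - l0 <= 0.
    rewrite subr_le0 leNgt; apply/negP => h.
    by have := pslope_decr K0 S0 V00 l00 h; rewrite pl0 Pz; lra.
  have hdl : 2^-1 * pslope (l t) ^+ 2 <= dl.
    by case: e2 => [e2|[-> _ ->]]; [lra|rewrite expr0n/= mulr0].
  split; last lra.
  by rewrite ler_wnM2l.
split.
  apply: (@dissipative_cvg R l l0 (L + l0)) => //.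
    move=> t t0; have [lt0 _] := hpos t t0; have := lL t t0.
    by rewrite ler_norml => h; apply/andP; split; lra.
  move=> e e0.
  (* decay rates for l <= l0 - e and for l >= l0 + e; the value 1 stands for the
     case in which l cannot get that far *)
  pose d1 := if 0 < l0 - e then e * (2^-1 * (pslope (l0 - e) ^+ 2 - P ^+ 2)) else 1.
  pose d2 := if 0 <= pslope (l0 + e) then e * (2^-1 * (P ^+ 2 - pslope (l0 + e) ^+ 2)) else 1.
  have d10 : 0 < d1.
    rewrite /d1; case: ifP => // le.
    have h : P < pslope (l0 - e) by rewrite -pl0; apply: pslope_decr => //; lra.
    by rewrite !mulr_gt0// subr_gt0 ltr_pXn2r// nnegrE (le_trans P0)// ltW.
  have d20 : 0 < d2.
    rewrite /d2; case: ifP => // le.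
    have h : pslope (l0 + e) < P by rewrite -pl0; apply: pslope_decr => //; lra.
    by rewrite !mulr_gt0// subr_gt0 ltr_pXn2r// nnegrE.
  exists (Num.min d1 d2); first by rewrite lt_min d10.
  apply: (ae_imp hae) => t ht t0; have [dl [dm [Dl Dm e1 e2]]] := ht t0.
  exists dl => //; have [h _] := key t dl dm t0 e1 e2; have [lt0 plt0] := hpos t t0.
  split.
    apply: le_trans h _; have [ll|ll] := leP (l t) l0.
      have : P <= pslope (l t) by rewrite -pl0; exact: pslope_le.
      move=> pp; rewrite mulr_le0_ge0 ?subr_le0// mulr_ge0// subr_ge0.
      by rewrite lerXn2r// nnegrE.
    have : pslope (l t) <= P by rewrite -pl0; apply: pslope_le => //; exact: ltW.
    move=> pp; apply: mulr_ge0_le0; first by rewrite subr_ge0 ltW.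
    by rewrite pmulr_rle0 ?invr_gt0// subr_le0 lerXn2r// nnegrE.
  move=> el; apply: le_trans h _; have [ll|ll] := leP (l t) l0.
    have le : l t <= l0 - e by move: el; rewrite ler0_norm ?subr_le0//; lra.
    have d1E : d1 = e * (2^-1 * (pslope (l0 - e) ^+ 2 - P ^+ 2)).
      by rewrite /d1 (lt_le_trans lt0 le).
    have pp : pslope (l0 - e) <= pslope (l t) by exact: pslope_le.
    have h1 : P < pslope (l0 - e) by rewrite -pl0; apply: pslope_decr => //; lra.
    have h2 : pslope (l0 - e) ^+ 2 <= pslope (l t) ^+ 2.
      by rewrite lerXn2r// nnegrE; lra.
    have h3 : P ^+ 2 < pslope (l0 - e) ^+ 2 by rewrite ltr_pXn2r// nnegrE; lra.
    apply: (@le_trans _ _ (- d1)); last by rewrite lerN2 ge_min lexx.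
    by rewrite d1E; nra.
  have le : l0 + e <= l t by move: el; rewrite gtr0_norm ?subr_gt0//; lra.
  have pp : pslope (l t) <= pslope (l0 + e) by apply: pslope_le => //; lra.
  have d2E : d2 = e * (2^-1 * (P ^+ 2 - pslope (l0 + e) ^+ 2)).
    by rewrite /d2 (le_trans plt0 pp).
  have h1 : pslope (l0 + e) < P by rewrite -pl0; apply: pslope_decr => //; lra.
  have h2 : pslope (l t) ^+ 2 <= pslope (l0 + e) ^+ 2 by rewrite lerXn2r// nnegrE; lra.
  have h3 : pslope (l0 + e) ^+ 2 < P ^+ 2 by rewrite ltr_pXn2r// nnegrE; lra.
  apply: (@le_trans _ _ (- d2)); last by rewrite lerN2 ge_min lexx orbT.
  by rewrite d2E; nra.
pose f t := m t + - wave_speed * t.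
have fE t : m t - wave_speed * t = f t by rewrite /f mulNr.
have lipf : half_lip f by apply: half_lipD => //; apply: half_lipZ; exact: half_lip_id.
have Df (t dm : R) : is_derive t 1 m dm -> is_derive t 1 f (dm + - wave_speed * 1).
  by move=> Dm; apply: is_derive_funD => //; exact: is_derive_funZ (is_derive_fun_id t).
have lipNf : half_lip (fun t => - 1 * f t) by exact: half_lipZ.
have anti (s t : R) : 0 <= s -> s <= t -> f t <= f s.
  move=> s0 st; suff : - 1 * f s <= - 1 * f t by rewrite !mulN1r lerN2.
  apply: (half_lip_nondecreasing lipNf) => //.
  apply: (ae_imp hae) => z hz z0; have [dl [dm [Dl Dm e1 e2]]] := hz z0.
  exists (- 1 * (dm + - wave_speed * 1)); first exact: is_derive_funZ (Df _ _ Dm).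
  by have [_ h] := key z dl dm z0 e1 e2; lra.
have [z hz] : exists z : R, f t @[t --> +oo] --> z.
  have [c|c] := ltP (V0 * S) (2 * beta).
    apply: (@antitone_cvg f (f 0)) => // t t0.
    apply: (half_lip_nondecreasing lipf) => //.
    apply: (ae_imp hae) => s hs s0; have [dl [dm [Dl Dm e1 e2]]] := hs s0.
    exists (dm + - wave_speed * 1); first exact: Df.
    rewrite /wave_speed c; case: e2 => [e2|[e2 e3 e4]]; first lra.
    by exfalso; rewrite e2 expr0n/= in e1; lra.
  (* m + l - c t is nondecreasing and l <= L *)
  apply: (@antitone_cvg f (f 0 + l 0 - L)) => // t t0.
  have lipg : half_lip (fun t => f t + l t) by exact: half_lipD.
  have : f 0 + l 0 <= f t + l t.
    apply: (half_lip_nondecreasing lipg) => //.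
    apply: (ae_imp hae) => s hs s0; have [dl [dm [Dl Dm e1 e2]]] := hs s0.
    exists (dm + - wave_speed * 1 + dl); first by apply: is_derive_funD => //; exact: Df.
    rewrite /wave_speed ltNge c/=; have := sqr_ge0 (pslope (l s)); lra.
  by have := lL t t0; lra.
by exists z; under eq_fun do rewrite fE.
Qed.

End dynamics.

(** * The traveling wave and the convergence to it *)
Section waves.
Context {R : realType}.
Variables (kappa alpha V0 beta : R).
Notation K := (kappa * cos alpha).
Notation S := (kappa * sin alpha).
Hypotheses (K0 : 0 < K) (S0 : 0 < S) (V00 : 0 < V0).
Notation drop := (drop kappa alpha V0).
Notation pslope := (pslope kappa alpha V0).
Notation qslope := (qslope kappa alpha V0).
Notation c := (wave_speed kappa alpha V0 beta).
Notation P := (wave_slope kappa alpha V0 beta).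

Lemma drop_shift l m s x : drop l m (x - s) = drop l (m + s) x.
Proof.
by rewrite drop_translate [RHS]drop_translate; congr (drop _ _ _); ring.
Qed.

Lemma drop_inj l m l' m' : 0 < l -> 0 < l' -> 0 <= pslope l -> 0 <= pslope l' ->
  drop l m = drop l' m' -> l = l' /\ m = m'.
Proof.
move=> l0 l'0 p0 p'0 e.
have := drop_support K0 S0 m l0 p0; rewrite e (drop_support K0 S0 m' l'0 p'0) => E.
have h1 : m - l < m + l by lra.
have h2 : m' - l' < m' + l' by lra.
have s1 : m' + l' = m + l.
  have := congr1 sup E; rewrite !sup_itv ?bnd_simp//.
have s2 : m' - l' = m - l.
  have := congr1 inf E; rewrite !inf_itv ?bnd_simp//.
by split; lra.
Qed.

Lemma linear_cvg_slope0 (k y z : R) : y + k * t @[t --> +oo] --> z -> k = 0.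
Proof.
move=> cv; apply: contrapT => /eqP k0.
have e0 : 0 < `|k| / 2 by rewrite divr_gt0// normr_gt0.
have [M [_ hM]] := (cvgrPdist_lt _ _).1 cv _ e0.
have h1 := hM (M + 1) (ltr_pwDr ltr01 (lexx M)).
have h2 := hM (M + 2) (ltr_pwDr (ltr0Sn _ 1) (lexx M)).
have : `|k| < `|k|.
  have {1}-> : k = (z - (y + k * (M + 1))) - (z - (y + k * (M + 2))) by ring.
  by apply: le_lt_trans (ler_normB _ _) _; have := splitr `|k|; lra.
by rewrite ltxx.
Qed.

(** If V0 S < 2 beta, both contact conditions hold as equations for the slope P.
    Otherwise P = 0, and the left condition only asks that c >= beta. *)
Lemma drop_traveling_wave l0 : 0 < l0 -> pslope l0 = P ->
  traveling_wave V0 kappa alpha (fun=> beta) (drop l0 0) c.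
Proof.
move=> l00 pl0; have P0 : 0 <= P by exact: sqrtr_ge0.
have p0 : 0 <= pslope l0 by rewrite pl0.
have wE t : (fun x => drop l0 0 (x - c * t)) = drop l0 (c * t).
  by apply/funext => x; rewrite drop_shift add0r.
have ab t : c * t - l0 < c * t + l0 by lra.
exists (drop l0 0), (0 - l0), (0 + l0); split.
  split; [lra|exact: drop_support|exact: drop_argmin].
have aff (y : R) : [/\ (exists k : R, k.-lipschitz_`[0, +oo[ (fun t => c * t + y)) &
    forall t : R, is_derive t 1 (fun t => c * t + y) c].
  split.
    exists `|c| => -[s t] _ /=.
    by rewrite [X in `|X|](_ : _ = c * (s - t)) ?normrM//; ring.
  move=> t; apply: is_derive_eq (is_derive_funD (is_derive_funZ c (is_derive_fun_id t))
    (is_derive_fun_cst y t)) _; ring.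
exists (fun t => c * t - l0), (fun t => c * t + l0); split.
- by have [] := aff (- l0).
- by have [] := aff l0.
- by rewrite mulr0.
- move=> t _; split; last by rewrite wE; exact: drop_argmin.
  by have := drop_support K0 S0 (c * t) l00 p0; rewrite -wE.
apply: aeW => t t0.
have [_ da] := aff (- l0); have [_ db] := aff l0.
split; [exact: ex_derive|exact: ex_derive|].
exists (pslope l0), (qslope l0); rewrite wE; split.
- exact: drop_right_derivative.
- exact: drop_left_derivative.
- have := derive_val (is_derive := da t); rewrite -derive1E => ->.
  rewrite pl0 (ger0_norm P0) /wave_speed /wave_slope; case: ifP => h.
    rewrite sqr_sqrtr; last lra.
    rewrite (_ : _ - beta = 0); last by field.
    by rewrite /Num.min; case: ifP => //; have := sqrtr_ge0 (2 * beta - V0 * S); lra.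
  have h' : 2 * beta <= V0 * S by move/negbT: h; rewrite -leNgt.
  rewrite ler0_sqrtr ?subr_le0// expr0n/= mulr0 addr0.
  by rewrite /Num.min; case: ifP => //; lra.
- have := derive_val (is_derive := db t); rewrite -derive1E => ->.
  rewrite real_normK ?num_real// (slopes_sq V0 K0 l00) pl0.
  rewrite (_ : _ - beta = 0).
    by rewrite /Num.min; case: ifP => //; have := normr_ge0 (qslope l0); lra.
  rewrite /wave_speed /wave_slope; case: ifP => h.
    by rewrite sqr_sqrtr; [field|lra].
  have h' : 2 * beta <= V0 * S by move/negbT: h; rewrite -leNgt.
  by rewrite ler0_sqrtr ?subr_le0// expr0n/=; field.
Qed.

Lemma solution_cvg l0 u0 w : 0 < l0 -> pslope l0 = P ->
  sliding_drop_solution V0 kappa alpha (fun=> beta) u0 w ->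
  exists l m : R -> R, [/\
    forall t : R, 0 <= t -> [/\ 0 < l t, 0 <= pslope (l t) & w ^~ t = drop (l t) (m t)],
    l t @[t --> +oo] --> l0 & exists z : R, m t - c * t @[t --> +oo] --> z].
Proof.
move=> l00 pl0 hw; have [l [m [lipl lipm hd hae]]] := solution_is_drop K0 S0 V00 hw.
exists l, m; have [|h1 h2] := drop_dynamics K0 S0 V00 lipl lipm l00 pl0 _ hae; last by split.
by move=> t t0; have [] := hd t t0.
Qed.

(** All drops along a wave are translates of each other, so the half-length is
    constant and equals its limit l0; and m 0 + (c' - c) t converges, which forces
    c' = c. *)
Lemma traveling_wave_unique l0 v' c' : 0 < l0 -> pslope l0 = P ->
  traveling_wave V0 kappa alpha (fun=> beta) v' c' ->
  c' = c /\ exists x1, forall x, v' x = drop l0 0 (x - x1).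
Proof.
move=> l00 pl0 [u0 hw]; have [l [m [hd cl [z cm]]]] := solution_cvg l00 pl0 hw.
have [ll0 pl00 w0] := hd 0 (lexx _).
have v'E : v' = drop (l 0) (m 0).
  by rewrite -w0; apply/funext => x; rewrite mulr0 subr0.
have lm (t : R) : 0 <= t -> l t = l 0 /\ m t = m 0 + c' * t.
  move=> t0; have [lt0 plt wt] := hd t t0; apply: drop_inj => //.
  by rewrite -wt v'E; apply/funext => x; rewrite drop_shift.
have t_ge0 : \forall t \near +oo, (0 : R) <= t.
  by apply: nbhs_pinfty_ge; exact: num_real.
have le : l 0 = l0.
  have cl' : l t @[t --> +oo] --> l 0.
    by apply: cvg_near_cst; apply: filterS t_ge0 => t /lm[-> _].
  exact: (cvg_unique _ cl' cl).
have ce : c' - c = 0.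
  apply: (@linear_cvg_slope0 _ (m 0) z).
  apply: cvg_trans cm; apply: near_eq_cvg; apply: filterS t_ge0 => t /lm[_ ->].
  by ring.
split; first by apply/eqP; rewrite -subr_eq0 ce.
exists (m 0) => x; rewrite v'E le; exact: drop_translate.
Qed.

Lemma solution_uniform_cvg l0 u0 w : 0 < l0 -> pslope l0 = P ->
  sliding_drop_solution V0 kappa alpha (fun=> beta) u0 w ->
  exists x0 : R,
    ereal_sup (range (fun x : R => `|w x t - drop l0 0 (x - c * t - x0)|%:E))
      @[t --> +oo] --> 0%E.
Proof.
move=> l00 pl0 hw; have [l [m [hd cl [z cm]]]] := solution_cvg l00 pl0 hw.
(* the wave is shifted by the limit z of m - c t *)
exists z; have t_ge0 : \forall t \near +oo, (0 : R) <= t.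
  by apply: nbhs_pinfty_ge; exact: num_real.
have lpos : \forall t \near +oo, 0 < l t by apply: filterS t_ge0 => t /hd[].
have cmz : m t - (c * t + z) @[t --> +oo] --> (0 : R).
  rewrite -(subrr z); rewrite (_ : (fun t => _) = (fun t => (m t - c * t) - z)).
    by apply: cvgB => //; exact: cvg_cst.
  by apply/funext => t; ring.
have H := @drop_uniform_cvg R kappa alpha V0 K0 S0 l m (fun t => c * t + z) l0 l00 lpos cl cmz.
apply: cvg_trans H.
apply: near_eq_cvg; apply: filterS t_ge0 => t /hd[_ _ wt].
rewrite (_ : (fun x => `|w x t - _|%:E) =
  (fun x => `|drop (l t) (m t) x - drop l0 (c * t + z) x|%:E))//.
apply/funext => x; have <- : w x t = drop (l t) (m t) x by rewrite -wt.
by rewrite [drop l0 (c * t + z) x]drop_translate opprD addrA.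
Qed.

End waves.

Theorem theorem2p4 (R : realType) (V0 kappa alpha beta : R)
    (hV0 : 0 < V0) (hkappa : 0 < kappa) (halpha : 0 < alpha < pi / 2) :
  exists (v : R -> R) (c : R),
    [/\ traveling_wave V0 kappa alpha (fun=> beta) v c,
        forall (v' : R -> R) (c' : R),
          traveling_wave V0 kappa alpha (fun=> beta) v' c' ->
          c' = c /\ exists x1 : R, forall x : R, v' x = v (x - x1),
        V0 <= 2 * beta / (kappa * sin alpha) ->
          c = 2^-1 * V0 * kappa * sin alpha,
        V0 >= 2 * beta / (kappa * sin alpha) ->
          c = V0 * kappa * sin alpha - beta &
        forall (u0 : R -> R) (w : R -> R -> R),
          sliding_drop_solution V0 kappa alpha (fun=> beta) u0 w ->
          exists x0 : R,
            ereal_sup (range (fun x : R => `|w x t - v (x - c * t - x0)|%:E))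
              @[t --> +oo] --> 0%E].
Proof.
have /andP[a0 a1] := halpha.
have K0 : 0 < kappa * cos alpha.
  by rewrite mulr_gt0// cos_gt0_pihalf// a1 andbT (lt_trans _ a0)// oppr_lt0 divr_gt0// pi_gt0.
have S0 : 0 < kappa * sin alpha by rewrite mulr_gt0// sin_gt0_pihalf// a0 a1.
have [l0 l00 pl0] := pslope_surj K0 S0 hV0 (sqrtr_ge0 (2 * beta - V0 * (kappa * sin alpha))).
exists (drop kappa alpha V0 l0 0), (wave_speed kappa alpha V0 beta); split.
- exact: drop_traveling_wave.
- by move=> v' c'; exact: traveling_wave_unique.
- rewrite ler_pdivlMr// /wave_speed le_eqVlt => /predU1P[e|->//].
  by rewrite e ltxx -!mulrA e; lra.
- by rewrite ler_pdivrMr// /wave_speed ltNge => ->.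
- by move=> u0 w; exact: solution_uniform_cvg.
Qed.
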